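(* Let $k\ge 0$ and let $S$ be a $k$-stellated sphere of dimension $d\ge 2k$, with vertex set $V$. Then there is a unique $k$-stacked $(d+1)$-ball $\overline{S}$ whose boundary is $S$ (and $\overline{S}$ is actually $k$-shelled). It is given by the formula $$\overline{S}=\left\{\alpha\subseteq V \;:\; \text{every subset of }\alpha\text{ of size}\le k+1\text{ is a face of }S\right\}.$$
   Context: All simplicial complexes are finite and abstract, and the empty set is a face of every complex. A triangulated sphere/ball is a simplicial complex whose geometric carrier is homeomorphic to a sphere/ball. For a finite set $\alpha$, $\overline{\alpha}$ is the complex of all subsets of $\alpha$ and $\partial\alpha$ the complex of all proper subsets. The join $X\ast Y$ (disjoint vertex sets) has as faces the disjoint unions of a face of $X$ and a face of $Y$. The standard sphere $S^d_{d+2}$ is $\partial\alpha$ with $\#\alpha=d+2$; the standard ball $B^{d}_{d+1}$ is $\overline{\alpha}$ with $\#\alpha=d+1$. Complexes are identified up to isomorphism. Bistellar moves: if $X$ is $d$-dimensional and $\alpha,\beta$ are disjoint nonempty sets with $\dim\alpha+\dim\beta=d$ (where $\dim\alpha=\#\alpha-1$) such that the set of faces of $X$ contained in $\alpha\sqcup\beta$ is exactly $\overline{\alpha}\ast\partial\beta$, then $Y=(X\setminus(\overline\alpha\ast\partial\beta))\cup(\partial\alpha\ast\overline\beta)$ is obtained from $X$ by the bistellar move $\alpha\mapsto\beta$, of index $\dim\beta$ (if $\beta$ is a single vertex, it is a new vertex). For $0\le k\le d+1$, a $d$-dimensional complex is $k$-stellated if it is obtained from $S^d_{d+2}$ by a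 finite sequence of bistellar moves, each of index $<k$ ($S^d_{d+2}$ is the only $0$-stellated one). Shelling moves: for pure $d$-dimensional complexes $Y\subseteq X$, $X$ is obtained from $Y$ by the shelling move $\alpha\leadsto\beta$ of index $\dim\beta$ if $\alpha$ and $\beta\ne\emptyset$ are disjoint faces of $X$, $\alpha\sqcup\beta$ is the only facet of $X$ that is not a facet of $Y$, and the set of faces of $Y$ contained in $\alpha\sqcup\beta$ is $\overline\alpha\ast\partial\beta$ ($\alpha=\emptyset$ is allowed). A weak pseudomanifold of dimension $d$ is a pure $d$-dimensional complex in which each $(d-1)$-face is in at most two facets; it is a pseudomanifold if moreover its dual graph (vertices = facets, adjacent when they meet in a $(d-1)$-face) is connected. The boundary $\partial X$ is the pure subcomplex whose facets are the $(d-1)$-faces lying in exactly one facet. A $d$-dimensional pseudomanifold is $k$-shelled ($0\le k\le d$) if it is obtained from $B^d_{d+1}$ by a finite sequence of shelling moves each of index $<k$ ($B^d_{d+1}$ is the only $0$-shelled one). For $0\le k\le d+1$, a triangulated $(d+1)$-ball $B$ is $k$-stacked if all faces of $B$ of dimension $\le d-k$ lie in $\partial B$. *)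

(* Defs.v *)
From mathcomp Require Import all_boot all_order all_algebra finmap.
From mathcomp Require Import boolp classical_sets functions reals topology.
From mathcomp Require Import normedtype.

Set Implicit Arguments.
Unset Strict Implicit.
Unset Printing Implicit Defensive.

Import Order.TTheory GRing.Theory Num.Theory.
Import numFieldNormedType.Exports.

Local Open Scope fset_scope.

(* Complexes have their vertices in an arbitrary choiceType K, and a face of
   dimension m is a face with m.+1 elements.  "Up to isomorphism" is rendered by
   admitting every simplex with vertices in K as a standard ball or sphere, and
   every element of K outside the complex as a new vertex.  When K is infinite
   the classes below are therefore closed under isomorphism.  A finite K could
   only exclude sequences of moves that pass through more vertices than K has;
   this needs moves deleting a vertex, i.e. bistellar moves of index d, which do
   not occur when every index is less than k <= d. *)

Section Combinatorics.
Variable K : choiceType.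
Implicit Types (X Y : {fset {fset K}}) (a b c r : {fset K}) (d i k : nat).

Definition simplicial_complex X : Prop :=
  fset0 \in X /\ forall a b, a \in X -> b `<=` a -> b \in X.

Definition vertices X : {fset K} := \bigcup_(a <- X) a.

Definition has_dim d X : Prop :=
  (exists2 a, a \in X & #|` a| = d.+1) /\
  (forall a, a \in X -> #|` a| <= d.+1).

Definition simplex a : {fset {fset K}} := fpowerset a.

Definition simplex_boundary a : {fset {fset K}} := fpowerset a `\ a.

(* The join; only used for complexes on disjoint vertex sets. *)
Definition join X Y : {fset {fset K}} := [fset a `|` b | a in X, b in Y].

Definition faces_within X c : {fset {fset K}} := [fset a in X | a `<=` c].

(* If b is a single vertex v, the condition on the faces of X contained in
   a `|` b says that a is a face of X and that v is not a vertex of X. *)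
Definition bistellar_move d i a b X Y : Prop :=
  [/\ simplicial_complex X /\ has_dim d X,
      [disjoint a & b] /\ a != fset0,
      #|` b| = i.+1 /\ (#|` a| + #|` b| = d.+2)%N,
      faces_within X (a `|` b) = join (simplex a) (simplex_boundary b)
    & Y = (X `\` join (simplex a) (simplex_boundary b))
            `|` join (simplex_boundary a) (simplex b)].

Inductive k_stellated d k : {fset {fset K}} -> Prop :=
| KStellatedStandard a : #|` a| = d.+2 -> k_stellated d k (simplex_boundary a)
| KStellatedMove i a b X Y : k_stellated d k X -> i < k ->
    bistellar_move d i a b X Y -> k_stellated d k Y.

(* Facets are only considered in d-dimensional pure complexes, where they are
   the d-dimensional faces. *)
Definition facets d X : {fset {fset K}} := [fset a in X | #|` a| == d.+1].

Definition pure d X : Prop :=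
  simplicial_complex X /\
  forall a, a \in X -> exists2 c, c \in facets d X & a `<=` c.

Definition facets_containing d X r : {fset {fset K}} :=
  [fset c in facets d X | r `<=` c].

Definition weak_pseudomanifold d X : Prop :=
  pure d X /\
  forall r, r \in X -> #|` r| = d -> #|` facets_containing d X r| <= 2.

Definition dual_adj d X : rel (facets d X) :=
  fun a b : facets d X => #|` fsval a `&` fsval b| == d.

Definition pseudomanifold d X : Prop :=
  weak_pseudomanifold d X /\ forall a b : facets d X, connect (@dual_adj d X) a b.

(* The empty face is added explicitly, as it belongs to every complex. *)
Definition boundary d X : {fset {fset K}} :=
  fset0 |` \bigcup_(r <- X | (#|` r| == d) &&
                             (#|` facets_containing d X r| == 1)) simplex r.

Definition shelling_move d i a b Y X : Prop :=
  [/\ pure d Y /\ pure d X,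
      Y `<=` X,
      [/\ a \in X, b \in X, #|` b| = i.+1 & [disjoint a & b]],
      facets d X `\` facets d Y = [fset a `|` b]
    & faces_within Y (a `|` b) = join (simplex a) (simplex_boundary b)].

Inductive shelling_sequence d k : {fset {fset K}} -> Prop :=
| ShellingStandard a : #|` a| = d.+1 -> shelling_sequence d k (simplex a)
| ShellingMove i a b Y X : shelling_sequence d k Y -> i < k ->
    shelling_move d i a b Y X -> shelling_sequence d k X.

Definition k_shelled d k X : Prop :=
  pseudomanifold d X /\ shelling_sequence d k X.

End Combinatorics.

Local Open Scope classical_set_scope.
Local Open Scope ring_scope.

Definition homeomorphic_sets (T U : topologicalType) (A : set T) (B : set U) :
    Prop :=
  exists (f : T -> U) (g : U -> T),
    [/\ {within A, continuous f}, {within B, continuous g},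
        forall x, A x -> B (f x) /\ g (f x) = x
      & forall y, B y -> A (g y) /\ f (g y) = y].

Section Balls.
Variables (R : realType) (K : choiceType).
Implicit Types (X : {fset {fset K}}) (d k n : nat).

(* Points are given by their barycentric coordinates, indexed by K. *)
Definition geometric_carrier X : set {ptws K -> R} :=
  [set x | exists2 a, a \in X &
     [/\ forall v, 0 <= x v, forall v, v \notin a -> x v = 0
       & \sum_(v <- a) x v = 1]].

Definition unit_ball n : set 'rV[R]_n :=
  [set x : 'rV[R]_n | \sum_j x 0 j ^+ 2 <= 1].

Definition triangulated_ball n X : Prop :=
  simplicial_complex X /\
  homeomorphic_sets (geometric_carrier X) (@unit_ball n).

(* B has dimension d + 1, and dim a <= d - k reads #a + k <= d + 1. *)
Definition k_stacked_ball d k (B : {fset {fset K}}) : Prop :=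
  triangulated_ball d.+1 B /\
  forall a, a \in B -> (#|` a| + k <= d.+1)%N -> a \in boundary d.+1 B.

End Balls.

(* Main.v *)
Require Import Defs.
From mathcomp Require Import all_boot all_order all_algebra finmap.
From mathcomp Require Import boolp classical_sets functions reals topology.
From mathcomp Require Import normedtype.
From mathcomp Require Import zify ring lra realfun.

(** Write F(X) for the complex given by the formula.  A bistellar move
    a |-> b of index < k changes F(X) by adding the simplex a b, and this is a
    shelling move; so F(S) is k-shelled, with boundary S.  This needs that the
    star of a in X lies in the simplex a b, which holds because X is a
    pseudomanifold all of whose links are strongly connected.

    Uniqueness is combinatorial: a k-stacked B with boundary S agrees with S up
    to dimension k, hence is contained in F(S), and F(S) has a connected dual
    graph with no room for a smaller set of facets with the same boundary.

    For the topology, F(X) is shown homeomorphic to the cone over X, relative to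
    X.  Gluing the simplex a b to the base of the cone over X along the join of
    a with the boundary of b is, one dimension up, a bistellar move turning this
    cone into the cone over Y; it is realised by moving mass from a to b and the
    apex until some coordinate in a vanishes.  The same map without apex shows
    that the cones over X and Y are homeomorphic, so all of them are balls. *)

Set Implicit Arguments.
Unset Strict Implicit.
Unset Printing Implicit Defensive.

Import Order.TTheory GRing.Theory Num.Theory.
Import numFieldNormedType.Exports.

(** * Normal pseudomanifolds and bistellar moves *)

Section FiniteSets.
Local Open Scope fset_scope.
Variable K : choiceType.
Implicit Types (a b c p q r s : {fset K}).

Lemma fsubset_cardS s c : s `<=` c -> #|` c| = #|` s|.+1 ->
  exists2 v, v \in c & s = c `\ v.
Proof.
move=> sc cc; have /cardfs1P[v cv] : #|` c `\` s| == 1.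
  by rewrite cardfsDS // cc; apply/eqP; lia.
have : v \in c `\` s by rewrite cv inE.
rewrite inE => /andP[vs vc]; exists v => //.
rewrite -cv; apply/fsetP => u; rewrite !inE.
by case us: (u \in s) => //=; [rewrite (fsubsetP sc)|case: (u \in c)].
Qed.

Lemma cardfsD1_in v c : v \in c -> #|` c `\ v| = #|` c|.-1.
Proof. by move=> vc; rewrite (cardfsD1 v c) vc. Qed.

Lemma card_fsetI_ridge n r p q : #|` p| = n.+1 -> #|` q| = n.+1 -> p != q ->
  #|` r| = n -> r `<=` p -> r `<=` q -> #|` p `&` q| = n.
Proof.
move=> cp cq pq cr rp rq.
have h1 : n <= #|` p `&` q| by rewrite -cr fsubset_leq_card // fsubsetI rp.
have h2 := fsubset_leq_card (fsubsetIl p q).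
apply/eqP; rewrite eqn_leq h1 andbT leqNgt; apply/negP => h3.
have e1 : p `&` q = p by apply/eqP; rewrite eqEfcard fsubsetIl cp.
have e2 : p `&` q = q by apply/eqP; rewrite eqEfcard fsubsetIr cq.
by rewrite -e1 {1}e2 eqxx in pq.
Qed.

(** Makes any two distinct facets of a simplex adjacent: the union of [p] and [q] is larger than
    either, hence all of [c]. *)
Lemma card_fsetI_in n c p q : #|` c| = n.+2 -> p `<=` c -> q `<=` c ->
  #|` p| = n.+1 -> #|` q| = n.+1 -> p != q -> #|` p `&` q| = n.
Proof.
move=> cc pc qc cp cq pq; have h := cardfsUI p q.
have h1 : #|` p `|` q| <= n.+2 by rewrite -cc fsubset_leq_card // fsubUset pc.
have h2 : n < #|` p `|` q|.
  rewrite ltnNge; apply/negP => h2; case/negP: pq.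
  have e : p = p `|` q by apply/eqP; rewrite eqEfcard fsubsetUl; lia.
  by rewrite eq_sym eqEfcard cp cq leqnn andbT e fsubsetUr.
have h3 : #|` p `|` q| != n.+1.
  apply: contra pq => /eqP h3.
  have e : p = p `|` q by apply/eqP; rewrite eqEfcard fsubsetUl; lia.
  by rewrite eq_sym eqEfcard cp cq leqnn andbT e fsubsetUr.
lia.
Qed.

(** Replaces the joins in the definition of a move by two inclusion tests, the form used from here
    on. *)
Lemma mem_join_boundary_r a b s : [disjoint a & b] ->
  (s \in join (simplex a) (simplex_boundary b)) =
  (s `<=` a `|` b) && ~~ (b `<=` s).
Proof.
move=> /fdisjointP ab; apply/imfset2P/andP => [[p]|[sab bs]].
  rewrite /= fpowersetE => pa [q]; rewrite /= !inE fpowersetE => /andP[qb qsb] ->.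
  split; first by rewrite fsetUSS.
  apply: contra qb => bs; rewrite eqEfsubset qsb /=.
  apply/fsubsetP => v vb; move/fsubsetP/(_ v vb): bs; rewrite inE => /orP[|//].
  by move=> /(fsubsetP pa)/ab; rewrite vb.
exists (s `&` a); first by rewrite /= fpowersetE fsubsetIr.
exists (s `&` b).
  rewrite /= !inE fpowersetE fsubsetIr andbT; apply: contra bs => /eqP <-.
  exact: fsubsetIl.
by rewrite -fsetIUr; apply/eqP; rewrite eq_sym; apply/eqP/fsetIidPl.
Qed.

Lemma mem_join_boundary_l a b s : [disjoint a & b] ->
  (s \in join (simplex_boundary a) (simplex b)) =
  (s `<=` a `|` b) && ~~ (a `<=` s).
Proof.
move=> ab; rewrite fsetUC -mem_join_boundary_r; last by rewrite fdisjoint_sym.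
by apply/imfset2P/imfset2P => -[p pa [q qb ->]]; exists q => //; exists p => //;
  rewrite fsetUC.
Qed.

Lemma mem_simplex_boundary a s :
  (s \in simplex_boundary a) = (s `<=` a) && ~~ (a `<=` s).
Proof.
rewrite !inE fpowersetE andbC; case sa: (s `<=` a) => //=.
by rewrite eqEfsubset sa.
Qed.

End FiniteSets.

(** * Strong connectivity of stars, and moves as exchanges of faces *)

Section Exchange.
Local Open Scope fset_scope.
Variable K : choiceType.
Implicit Types (X Y : {fset {fset K}}) (a b c f g p q r s : {fset K}).

(** Connectivity of the dual graph of the star of [s], encoded as an induction principle: whatever
    passes between adjacent facets passes from any facet to any other. With [s] empty this is strong
    connectivity of [X]. *)
Definition star_connected d X s : Prop :=
  forall (T : {fset K} -> Prop) f g,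
    (forall p q, p \in facets_containing d X s ->
       q \in facets_containing d X s -> #|` p `&` q| = d -> T p -> T q) ->
    f \in facets_containing d X s -> g \in facets_containing d X s ->
    T f -> T g.

(** Phrased with the vertices added to the ridge, so that a move can be followed by renaming one
    vertex. *)
Definition at_most_two_cofaces d X : Prop :=
  forall r u v w, #|` r| = d -> u \notin r -> v \notin r -> w \notin r ->
    u != v -> u != w -> v != w ->
    u |` r \in X -> v |` r \in X -> w |` r \in X -> False.

Definition normal_pseudomanifold d X : Prop :=
  [/\ pure d X, at_most_two_cofaces d X &
      forall s, s \in X -> star_connected d X s].

Lemma in_facets_containing d X s f : (f \in facets_containing d X s) =
  [&& f \in X, #|` f| == d.+1 & s `<=` f].
Proof. by rewrite !inE andbA. Qed.

Lemma in_facets d X f : (f \in facets d X) = (f \in X) && (#|` f| == d.+1).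
Proof. by rewrite !inE. Qed.

(** A move in symmetric form: swapping [X], [a] with [Y], [b] permutes the fields. No dimension
    occurs, so that [X] and [b] may be empty, which is how the topological induction starts. *)
Record exchange X Y a b : Prop := Exchange {
  exch_b : forall s, s \in X -> ~~ (b `<=` s);
  exch_a : forall s, s \in Y -> ~~ (a `<=` s);
  exch_star_a : forall s, s \in X -> a `<=` s -> s `<=` a `|` b;
  exch_star_b : forall s, s \in Y -> b `<=` s -> s `<=` a `|` b;
  exch_XY : forall s, s \in X -> ~~ (a `<=` s) -> s \in Y;
  exch_YX : forall s, s \in Y -> ~~ (b `<=` s) -> s \in X;
  exch_Y : forall s, s `<=` a `|` b -> ~~ (a `<=` s) -> s \in Y;
  exch_X : forall s, s `<=` a `|` b -> ~~ (b `<=` s) -> s \in X }.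

Lemma exchange_mem X Y a b s : exchange X Y a b ->
  (s \in Y) = (s \in X) && ~~ (s `<=` a `|` b) || (s `<=` a `|` b) && ~~ (a `<=` s).
Proof.
move=> E; apply/idP/orP => [sY|[/andP[sX sab]|/andP[sab asN]]].
- case sab: (s `<=` a `|` b); first by right; exact: (exch_a E).
  left; rewrite andbT; apply: (exch_YX E) => //.
  by apply/negP => /(exch_star_b E sY); rewrite sab.
- by apply: (exch_XY E) => //; apply: contra sab; exact: (exch_star_a E).
- exact: (exch_Y E).
Qed.

End Exchange.

(** * Bistellar moves preserve normal pseudomanifolds *)

Section Move.
Local Open Scope fset_scope.
Variable K : choiceType.
Implicit Types (f g p q r s : {fset K}).
Variables (X Y : {fset {fset K}}) (a b : {fset K}) (d i : nat).
Hypotheses (NX : normal_pseudomanifold d X) (M : bistellar_move d i a b X Y).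

Let ab_disj : [disjoint a & b]. Proof. by case: M => _ []. Qed.
Let card_ab : #|` a `|` b| = d.+2.
Proof.
case: M => _ _ [_ <-] _ _; rewrite -cardfsUI.
by move: ab_disj; rewrite /fdisjoint => /eqP ->; rewrite cardfs0 addn0.
Qed.
Let Xcl s p : s \in X -> p `<=` s -> p \in X.
Proof. by case: M => -[[_ cl] _] _ _ _ _; exact: cl. Qed.
Let Xsub s : s `<=` a `|` b -> (s \in X) = ~~ (b `<=` s).
Proof.
move=> sab; case: M => _ _ _ /fsetP/(_ s) + _.
by rewrite mem_join_boundary_r // !inE sab andbT.
Qed.
Let memY s : (s \in Y) = (s \in X) && ~~ (s `<=` a `|` b) ||
  (s `<=` a `|` b) && ~~ (a `<=` s).
Proof.
case: M => _ _ _ _ ->.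
rewrite inE inE mem_join_boundary_r // mem_join_boundary_l //.
case sab : (s `<=` a `|` b) => /=; last by rewrite andbT.
by rewrite Xsub //; case: (b `<=` s).
Qed.
Let notin_ab v : v \in a -> v \in b -> False.
Proof. by move=> /(fdisjointP ab_disj)/negP. Qed.
Let bN0 : exists v, v \in b.
Proof. by case: M => _ _ [cb _] _ _; apply/fset0Pn; rewrite -cardfs_gt0 cb. Qed.

Let facet_in s : s `<=` a `|` b -> #|` s| = d.+1 ->
  exists2 v, v \in a `|` b & s = (a `|` b) `\ v.
Proof. by move=> sab cs; apply: fsubset_cardS => //; rewrite cs. Qed.

Let card_facet v : v \in a `|` b -> #|` (a `|` b) `\ v| = d.+1.
Proof. by move=> vab; rewrite cardfsD1_in // card_ab. Qed.

Let sub_facet s v : s `<=` a `|` b -> v \notin s -> s `<=` (a `|` b) `\ v.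
Proof. by move=> sab vs; rewrite fsubsetD1 sab. Qed.

Let XfacetN v : v \in b -> (a `|` b) `\ v \in X.
Proof.
move=> vb; rewrite Xsub ?fsubD1set //; apply/negP => /fsubsetP/(_ v vb).
by rewrite !inE eqxx.
Qed.

Let YfacetN v : v \in a -> (a `|` b) `\ v \in Y.
Proof.
move=> va; rewrite memY fsubD1set /= orbC; apply/orP; left.
by apply/negP => /fsubsetP/(_ v va); rewrite !inE eqxx.
Qed.

(* The facets [(a `|` b) `\ v], [v \in b], already form a set of facets through
   [a] closed under adjacency, since every ridge lies in at most two facets. *)
Lemma move_star s : s \in X -> a `<=` s -> s `<=` a `|` b.
Proof.
case: NX => -[_ pX] two conn sX as_.
have aX : a \in X by apply: Xcl as_.
have [v vb] := bN0.
have [g gX sg] := pX _ sX.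
apply: (fsubset_trans sg).
have agf : a `<=` (a `|` b) `\ v.
  by rewrite fsubsetD1 fsubsetUl /=; apply/negP => /notin_ab; apply.
apply: (conn a aX (fun f => f `<=` a `|` b) ((a `|` b) `\ v) g).
- move=> p q; rewrite !in_facets_containing => /and3P[pXX /eqP cp ap].
  move=> /and3P[qX /eqP cq aq] cpq pab; apply: contrapT => qab.
  (* [u] is the vertex missing from [p], while [w] and [z] are what [p] and [q] add to their common
     ridge. If [q] left the simplex, adding [u], [w] and [z] to that ridge would give three
     cofaces. *)
  have [u uab pu] := facet_in pab cp.
  have ub : u \in b.
    move: uab; rewrite inE => /orP[ua|//]; have := fsubsetP ap u ua.
    by rewrite pu !inE eqxx.
  have [w wp rw] := fsubset_cardS (fsubsetIl p q) (etrans cp (congr1 S (esym cpq))).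
  have [z zq rz] := fsubset_cardS (fsubsetIr p q) (etrans cq (congr1 S (esym cpq))).
  have wa : w \notin a.
    apply/negP => wa; have : w \in p `&` q.
      by rewrite inE (fsubsetP ap) // (fsubsetP aq).
    by rewrite rw !inE eqxx.
  have wb : w \in b.
    by have := fsubsetP pab w wp; rewrite inE (negPf wa).
  have wu : u != w by apply/eqP => e; move: wp; rewrite -e pu !inE eqxx.
  have zab : z \notin a `|` b.
    apply: contra_notN qab => zab; apply/fsubsetP => y yq.
    have [->//|yz] := eqVneq y z.
    have : y \in p `&` q by rewrite rz !inE yz.
    by rewrite inE => /andP[/(fsubsetP pab)].
  have e1 : w |` (p `&` q) = p by rewrite rw fsetD1K.
  have e2 : z |` (p `&` q) = q by rewrite rz fsetD1K.
  have e3 : u |` (p `&` q) = (a `|` b) `\ w.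
    rewrite rw pu; apply/fsetP => y; rewrite !inE.
    by case: eqVneq => [->|//]; rewrite wu ub orbT.
  apply: (two (p `&` q) u w z cpq) => //.
  + by rewrite rw pu !inE eqxx andbF.
  + by rewrite rw !inE eqxx.
  + by rewrite rz !inE eqxx.
  + by apply: contraNneq zab => <-; rewrite inE ub orbT.
  + by apply: contraNneq zab => <-; rewrite inE wb orbT.
  + by rewrite e3 XfacetN.
  + by rewrite e1.
  + by rewrite e2.
- by rewrite in_facets_containing XfacetN // card_facet ?eqxx // inE vb orbT.
- move: gX; rewrite in_facets_containing inE => /andP[-> ->] /=.
  exact: fsubset_trans as_ sg.
- exact: fsubD1set.
Qed.

(** The fields [exch_a] and [exch_star_a] rest on [move_star]; the others are read off the
    membership tests for [X] and [Y]. *)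
Lemma move_exchange : exchange X Y a b.
Proof.
have bX s : s \in X -> ~~ (b `<=` s).
  move=> sX; apply/negP => bs.
  by have := Xcl sX bs; rewrite Xsub ?fsubsetUr // fsubset_refl.
split=> // s.
- rewrite memY => /orP[/andP[sX sab]|/andP[]//].
  by apply: contra sab; exact: move_star.
- exact: move_star.
- by rewrite memY => /orP[/andP[/bX/negP]|/andP[]].
- move=> sX asN; rewrite memY sX asN andbT /=.
  by case: (s `<=` a `|` b).
- rewrite memY => /orP[/andP[]//|/andP[sab asN] bs].
  by rewrite Xsub.
- by move=> sab asN; rewrite memY sab asN orbT.
- by move=> sab; rewrite Xsub.
Qed.

Lemma move_complex : simplicial_complex Y.
Proof.
have E := move_exchange; split.
  apply: (exch_Y E); rewrite ?fsub0set // fsubset0.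
  by case: M => _ [].
move=> s p sY ps; case pab : (p `<=` a `|` b).
  by apply: (exch_Y E) => //; apply: contra (exch_a E sY) => /fsubset_trans; apply.
move: sY; rewrite !memY => /orP[/andP[sX _]|/andP[sab _]].
  by rewrite (Xcl sX ps) pab.
by rewrite (fsubset_trans ps sab) in pab.
Qed.

Lemma move_pure : pure d Y.
Proof.
have E := move_exchange; split; first exact: move_complex.
move=> s sY; case sab : (s `<=` a `|` b).
  have /fsubsetPn[v va vs] := exch_a E sY.
  exists ((a `|` b) `\ v); last exact: sub_facet.
  by rewrite in_facets YfacetN //= card_facet // inE va.
have sX : s \in X by move: sY; rewrite memY sab andbT orbF.
case: NX => -[_ /(_ s sX)[g + sg]] _ _; rewrite in_facets => /andP[gX cg].
exists g => //; rewrite in_facets cg andbT memY gX /=.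
suff -> : (g `<=` a `|` b) = false by [].
by apply/negP => /(fsubset_trans sg); rewrite sab.
Qed.

(** Only ridges [r] inside the simplex on [a] and [b] need care. If [r] contains [b], its cofaces
    stay in that simplex, which has only [d.+2] vertices. Otherwise [r] misses just one vertex [p]
    of [a] and one vertex [q] of [b], and [p] plays in [X] the role of [q] in [Y]. *)
Lemma move_at_most_two : at_most_two_cofaces d Y.
Proof.
have E := move_exchange; have [_ two _] := NX.
move=> r u v w cr ur vr wr uv uw vw uY vY wY.
case rab : (r `<=` a `|` b); last first.
  apply: (two r u v w cr) => //; [move: uY|move: vY|move: wY];
  by rewrite memY fsubUset rab andbF /= andbT orbF.
case br : (b `<=` r).
  have inab x : x |` r \in Y -> x \in a `|` b.
    move=> /(exch_star_b E); rewrite fsubUset fsub1set => /(_ _)/andP[] //.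
    exact: fsubset_trans br (fsubsetU1 _ _).
  have : #|` u |` (v |` (w |` r))| <= #|` a `|` b|.
    by apply: fsubset_leq_card; rewrite !fsubUset !fsub1set !inab.
  rewrite card_ab !cardfsU1 !inE !negb_or uv uw vw ur vr wr cr /=; lia.
have aNr : ~~ (a `<=` r).
  by apply: contra (exch_a E uY) => /fsubset_trans; apply; exact: fsubsetU1.
have /fsubsetPn[p pa pr] := aNr.
have /fsubsetPn[q qb qr] := negbT br.
have pq : p != q by apply/eqP => e; apply: (notin_ab pa); rewrite e.
have abE : a `|` b = p |` (q |` r).
  apply/eqP; rewrite eq_sym eqEfcard !fsubUset !fsub1set !inE pa qb orbT rab /=.
  by rewrite card_ab !cardfsU1 !inE negb_or pq pr qr cr.
have xNp x : x |` r \in Y -> x != p.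
  move=> /(exch_a E); apply: contra => /eqP ->; apply/fsubsetP => y ya.
  have : y \in a `|` b by rewrite inE ya.
  rewrite abE !inE => /or3P[->|/eqP yq|->]; rewrite ?orbT //.
  by case: (notin_ab ya); rewrite yq.
have pX : p |` r \in X.
  apply: (exch_X E); first by rewrite abE fsetUS // fsubsetU1.
  by apply/negP => /fsubsetP/(_ q qb); rewrite !inE eq_sym (negPf pq) (negPf qr).
(* Adding [p] to [r] gives a face of [X] that is not in [Y], so this renaming is injective on the
   cofaces in [Y] and lands in [X]. *)
pose h x := if x == q then p else x.
have hX x : x \notin r -> x |` r \in Y -> h x |` r \in X.
  rewrite /h => xr; case: eqVneq => // xq xY.
  move: (xY); rewrite memY => /orP[/andP[] //|/andP[]].
  by rewrite fsubUset fsub1set abE !inE (negPf xq) (negPf (xNp _ xY)) (negPf xr).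
have hr x : x \notin r -> h x \notin r by rewrite /h; case: ifP.
have hN x y : x |` r \in Y -> y |` r \in Y -> x != y -> h x != h y.
  move=> /xNp xp /xNp yp xy; rewrite /h.
  case: (x =P q) => [xq|_]; case: (y =P q) => [yq|_] //; last by rewrite eq_sym.
  by rewrite xq yq eqxx in xy.
by apply: (two r (h u) (h v) (h w)) => //; auto.
Qed.

(** Facets inside the simplex on [a] and [b] are pairwise adjacent and form one block. In the main
    case a chain of facets of [X] through [s] turns into one of [Y] when the block of removed facets
    is replaced by the block of new ones. *)
Lemma move_star_connected s : s \in Y -> star_connected d Y s.
Proof.
have E := move_exchange; have [[_ pX] _ conn] := NX.
move=> sY T f g; set F := facets_containing d Y s => clT fF gF Tf.
have inF p : p \in F -> [/\ p \in Y, #|` p| = d.+1 & s `<=` p].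
  by rewrite in_facets_containing => /and3P[-> /eqP -> ->].
have insideT p q : p \in F -> q \in F -> p `<=` a `|` b -> q `<=` a `|` b ->
    T p -> T q.
  move=> pF qF pab qab Tp; have [<-//|pq] := eqVneq p q.
  apply: (clT p) => //; have [_ cp _] := inF _ pF; have [_ cq _] := inF _ qF.
  exact: (card_fsetI_in card_ab).
case sab : (s `<=` a `|` b); last first.
  have Nab p : s `<=` p -> (p `<=` a `|` b) = false.
    by move=> sp; apply/negP => /(fsubset_trans sp); rewrite sab.
  have eF : facets_containing d X s = F.
    apply/fsetP => p; rewrite !in_facets_containing memY.
    case sp : (s `<=` p); rewrite ?andbF //.
    by rewrite (Nab _ sp) /= orbF !andbT.
  have sX : s \in X by move: sY; rewrite memY sab andbT orbF.
  by apply: (conn s sX T f g); rewrite ?eF.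
case bs : (b `<=` s).
  apply: (insideT f g) => //.
  - by have [fY _ sf] := inF _ fF; apply: (exch_star_b E) => //; exact: fsubset_trans bs sf.
  - by have [gY _ sg] := inF _ gF; apply: (exch_star_b E) => //; exact: fsubset_trans bs sg.
have /fsubsetPn[v vb vs] := negbT bs.
have sX : s \in X by apply: (exch_YX E) => //; rewrite bs.
have outX p : p \in X -> ~~ (p `<=` a `|` b) -> p \in Y.
  by move=> pXX pab; rewrite memY pXX pab.
(* [T'] agrees with [T] outside the block; on the block it asks for some new facet satisfying
   [T]. *)
pose T' p := if p `<=` a `|` b then exists2 q, q \in F /\ q `<=` a `|` b & T q else T p.
(* A facet [q] outside the block that is adjacent to a removed facet is also adjacent to a new one,
   namely the one opposite a vertex [u] of [a] missing from [q]: it contains the same ridge. *)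
have bridge p q : p \in X -> #|` p| = d.+1 -> s `<=` p -> p `<=` a `|` b ->
    q \in X -> #|` q| = d.+1 -> s `<=` q -> ~~ (q `<=` a `|` b) ->
    #|` p `&` q| = d ->
    exists h, [/\ h \in F, h `<=` a `|` b & #|` h `&` q| = d].
  move=> pXX cp sp pab qX cq sq qab cpq.
  have aNq : ~~ (a `<=` q) by apply: contra qab; exact: (exch_star_a E).
  have /fsubsetPn[u ua uq] := aNq.
  have pqab : p `&` q `<=` a `|` b by apply: fsubset_trans pab; exact: fsubsetIl.
  exists ((a `|` b) `\ u); split; last 2 first.
  - exact: fsubD1set.
  - apply: (@card_fsetI_ridge _ _ (p `&` q)) => //.
    + by rewrite card_facet // inE ua.
    + by apply: contraNneq qab => <-; exact: fsubD1set.
    + by apply: sub_facet => //; rewrite inE (negPf uq) andbF.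
    + exact: fsubsetIr.
  rewrite in_facets_containing YfacetN //= card_facet ?inE ?ua // eqxx /=.
  by apply: sub_facet => //; apply: contra uq; exact: (fsubsetP sq).
have XF p : p \in facets_containing d X s -> [/\ p \in X, #|` p| = d.+1 & s `<=` p].
  by rewrite in_facets_containing => /and3P[-> /eqP -> ->].
have outF p : p \in facets_containing d X s -> ~~ (p `<=` a `|` b) -> p \in F.
  by move=> /XF[pXX cp sp] pab; rewrite in_facets_containing outX // cp eqxx.
have clT' p q : p \in facets_containing d X s -> q \in facets_containing d X s ->
    #|` p `&` q| = d -> T' p -> T' q.
  move=> pF qF cpq; rewrite /T'.
  have [pXX cp sp] := XF _ pF; have [qX cq sq] := XF _ qF.
  case pab : (p `<=` a `|` b); case qab : (q `<=` a `|` b) => //.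
  - move=> [h [hF hab] Th].
    have [h' [h'F h'ab ch']] := bridge p q pXX cp sp pab qX cq sq (negbT qab) cpq.
    apply: (clT h') => //; first by apply: outF => //; rewrite qab.
    exact: (insideT h).
  - move=> Tp; rewrite fsetIC in cpq.
    have [h' [h'F h'ab ch']] := bridge q p qX cq sq qab pXX cp sp (negbT pab) cpq.
    exists h' => //; apply: (clT p) => //; first by apply: outF => //; rewrite pab.
    by rewrite fsetIC.
  - by apply: clT => //; apply: outF => //; rewrite ?pab ?qab.
have wF : (a `|` b) `\ v \in facets_containing d X s.
  rewrite in_facets_containing XfacetN // card_facet ?inE ?vb ?orbT // eqxx /=.
  exact: sub_facet.
have T'all p : p \in facets_containing d X s -> T' p.
  move=> pF; case fab : (f `<=` a `|` b).
    apply: (conn s sX T' _ p clT' wF pF).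
    by rewrite /T' fsubD1set; exists f.
  have [fY cf sf] := inF _ fF.
  apply: (conn s sX T' f p clT' _ pF); last by rewrite /T' fab.
  rewrite in_facets_containing cf eqxx sf andbT.
  by move: fY; rewrite memY fab andbT orbF.
have [gY cg sg] := inF _ gF.
case gab : (g `<=` a `|` b).
  by have := T'all _ wF; rewrite /T' fsubD1set => -[h [hF hab]]; exact: insideT.
have gX : g \in X by move: gY; rewrite memY gab andbT orbF.
have := T'all g; rewrite /T' gab; apply.
by rewrite in_facets_containing gX cg eqxx.
Qed.

Lemma move_normal : normal_pseudomanifold d Y.
Proof.
split; [exact: move_pure|exact: move_at_most_two|exact: move_star_connected].
Qed.

End Move.

(** * Boundaries of simplices *)

Section Standard.
Local Open Scope fset_scope.
Variable K : choiceType.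

Lemma simplex_boundary_normal (a : {fset K}) d : #|` a| = d.+2 ->
  normal_pseudomanifold d (simplex_boundary a).
Proof.
move=> ca; split; first split; first split.
- by rewrite mem_simplex_boundary fsub0set fsubset0 -cardfs_eq0 ca.
- move=> s p; rewrite !mem_simplex_boundary => /andP[sa asN] ps.
  rewrite (fsubset_trans ps sa) /=; apply: contra asN => /fsubset_trans; exact.
- move=> s; rewrite mem_simplex_boundary => /andP[sa /fsubsetPn[v va vs]].
  exists (a `\ v); last by rewrite fsubsetD1 sa.
  rewrite in_facets cardfsD1_in // ca eqxx andbT mem_simplex_boundary fsubD1set /=.
  by apply/negP => /fsubsetP/(_ v va); rewrite !inE eqxx.
- move=> r u v w cr ur vr wr uv uw vw; rewrite !mem_simplex_boundary.
  move=> /andP[ua _] /andP[va _] /andP[wa _].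
  have : #|` u |` (v |` (w |` r))| <= #|` a|.
    apply: fsubset_leq_card; move: ua va wa; rewrite !fsubUset.
    by move=> /andP[-> ->] /andP[-> _] /andP[-> _].
  by rewrite ca !cardfsU1 !inE !negb_or uv uw vw ur vr wr cr /=; lia.
- move=> s sX T f g clT fF gF Tf; have [<-//|fg] := eqVneq f g.
  apply: (clT f) => //; move: fF gF; rewrite !in_facets_containing.
  rewrite !mem_simplex_boundary => /and3P[/andP[fa _] /eqP cf _].
  by move=> /and3P[/andP[ga _] /eqP cg _]; exact: (card_fsetI_in ca).
Qed.

End Standard.

(** * Fillings *)

Section Filling.
Local Open Scope fset_scope.
Variable K : choiceType.
Implicit Types (X Y Z : {fset {fset K}}) (a b c f g p q r s : {fset K}).

Definition filling k X : {fset {fset K}} :=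
  [fset c in fpowerset (vertices X) |
    all (fun p => (#|` p| <= k.+1) ==> (p \in X)) (fpowerset c)].

Lemma mem_filling k X c : c \in filling k X <->
  c `<=` vertices X /\ forall p, p `<=` c -> #|` p| <= k.+1 -> p \in X.
Proof.
rewrite !inE fpowersetE; split=> [/andP[-> /allP h]|[-> h]].
  by split=> // p pc cp; have := h p; rewrite fpowersetE pc cp => /(_ isT).
by apply/allP => p; rewrite fpowersetE => pc; apply/implyP; exact: h.
Qed.

Lemma mem_vertices X v : simplicial_complex X ->
  (v \in vertices X) = ([fset v] \in X).
Proof.
move=> [_ cl]; apply/bigfcupP/idP => [[s /andP[sX _] vs]|vX].
  by apply: cl sX _; rewrite fsub1set.
by exists [fset v]; rewrite ?vX // inE.
Qed.

(** Singletons have size at most [k.+1], so the test on small subsets already makes the elements of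
    [c] vertices of [X]. *)
Lemma mem_filling_complex k X c : simplicial_complex X ->
  c \in filling k X <-> (forall p, p `<=` c -> #|` p| <= k.+1 -> p \in X).
Proof.
move=> cX; rewrite mem_filling; split=> [[]//|h]; split=> //.
apply/fsubsetP => v vc; rewrite mem_vertices //; apply: h.
  by rewrite fsub1set.
by rewrite cardfs1.
Qed.

(** A new face outside the simplex on [a] and [b] would contain [b] and a further vertex [v]; as [b]
    has at most [k] elements, adding [v] gives a tested set, against [exch_star_b]. Conversely [a]
    has more than [k.+1] elements, so no tested set contains it and none is lost. *)
Lemma filling_exchange k X Y a b :
  simplicial_complex X -> simplicial_complex Y -> exchange X Y a b ->
  #|` b| <= k -> k.+1 < #|` a| ->
  filling k Y = filling k X `|` fpowerset (a `|` b).
Proof.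
move=> cX cY E cb ca.
have aN p : #|` p| <= k.+1 -> ~~ (a `<=` p).
  by move=> cp; apply/negP => /fsubset_leq_card; lia.
apply/fsetP => c; rewrite inE fpowersetE; apply/idP/orP.
- move=> /(mem_filling_complex _ _ cY) h.
  case cab : (c `<=` a `|` b); [by right|left].
  apply/(mem_filling_complex _ _ cX) => p pc cp.
  apply: (exch_YX E); first exact: h.
  apply/negP => bp; move: cab => /negbT/fsubsetPn[v vc vab].
  have : v |` b \in Y.
    apply: h; first by rewrite fsubUset fsub1set vc (fsubset_trans bp).
    rewrite cardfsU1; case: (v \notin b) => /=; lia.
  by move=> /(exch_star_b E)/(_ (fsubsetU1 _ _)); rewrite fsubUset fsub1set (negPf vab).
- move=> [/(mem_filling_complex _ _ cX) h|cab]; apply/(mem_filling_complex _ _ cY) => p pc cp.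
    by apply: (exch_XY E); [exact: h|exact: aN].
  by apply: (exch_Y E); [exact: fsubset_trans pc cab|exact: aN].
Qed.

(** The invariants carried along the moves. They prescribe the boundary on ridges only, and
    connectivity only at the empty face, that is for [Z] as a whole. *)
Record stacked_filling d k X Z : Prop := StackedFilling {
  fill_pure : pure d.+1 Z;
  fill_shelled : shelling_sequence d.+1 k Z;
  fill_coface : forall r, #|` r| = d.+1 -> r \in Z ->
    #|` facets_containing d.+1 Z r| <= 2;
  fill_boundary : forall r, #|` r| = d.+1 ->
    (r \in X) = (#|` facets_containing d.+1 Z r| == 1);
  fill_connected : star_connected d.+1 Z fset0;
  fill_sub : X `<=` Z;
  fill_stacked : forall s, s \in Z -> #|` s| + k <= d.+1 -> s \in X }.

(** As [X] is pure, both complexes are generated by their faces of size [d.+1], on which they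
    agree. *)
Lemma boundary_eqP d X Z : pure d X -> simplicial_complex Z ->
  (forall r, #|` r| = d.+1 ->
     (r \in X) = (#|` facets_containing d.+1 Z r| == 1)) ->
  boundary d.+1 Z = X.
Proof.
move=> [[X0 cl] pX] [_ clZ] h; apply/fsetP => s; rewrite inE; apply/orP/idP.
- move=> [|/bigfcupP[r /and3P[rZ /eqP cr r1]]]; first by rewrite inE => /eqP ->.
  by rewrite fpowersetE; apply: cl; rewrite h.
- move=> /pX[r]; rewrite in_facets => /andP[rX /eqP cr] sr; right.
  have r1 : #|` facets_containing d.+1 Z r| == 1 by rewrite -h.
  apply/bigfcupP; exists r; rewrite ?fpowersetE //= cr eqxx r1 !andbT.
  move: r1 => /cardfs1P[f /fsetP/(_ f)].
  by rewrite in_facets_containing inE eqxx => /and3P[fZ _ rf]; exact: clZ rf.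
Qed.

Lemma mem_boundary_ridge d Z r : simplicial_complex Z -> #|` r| = d.+1 ->
  (r \in boundary d.+1 Z) = (#|` facets_containing d.+1 Z r| == 1).
Proof.
move=> [_ clZ] cr; rewrite inE; apply/orP/idP => [[|]|r1].
- by rewrite inE -cardfs_eq0 cr.
- move=> /bigfcupP[p /and3P[pZ /eqP cp p1]]; rewrite fpowersetE => rp.
  suff -> : r = p by [].
  by apply/eqP; rewrite eqEfcard rp cr cp leqnn.
- right; apply/bigfcupP; exists r; rewrite ?fpowersetE ?cr ?eqxx ?r1 ?andbT //.
  move: r1 => /cardfs1P[f /fsetP/(_ f)].
  by rewrite in_facets_containing inE eqxx => /and3P[fZ _ rf]; exact: clZ rf.
Qed.

(** Strong connectivity is applied to the predicate of being reachable from [f] in the dual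
    graph. *)
Lemma filling_pseudomanifold d k X Z : stacked_filling d k X Z ->
  pseudomanifold d.+1 Z.
Proof.
move=> [pZ _ two _ conn _ _]; split.
  by split=> // r rZ cr; exact: two.
move=> f g; pose T c := exists c' : facets d.+1 Z,
  fsval c' = c /\ connect (@dual_adj K d.+1 Z) f c'.
have inF (c : facets d.+1 Z) : fsval c \in facets_containing d.+1 Z fset0.
  by have := valP c; rewrite in_facets in_facets_containing fsub0set andbT.
have [||||g' [/val_inj -> //]] := conn T (fsval f) (fsval g) => //.
- move=> p q _; rewrite in_facets_containing fsub0set andbT -in_facets => qF cpq [c [cp fc]].
  exists [` qF]; split=> //; apply: connect_trans fc (connect1 _).
  by rewrite /dual_adj /= /dual_adj; rewrite cp cpq.
- by exists f.
Qed.

(** * The effect of one bistellar move on the filling *)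

Section Step.
Variables (d i k : nat) (X Y Z : {fset {fset K}}) (a b : {fset K}).
Hypotheses (hd : 2 * k <= d) (ik : i < k) (NX : normal_pseudomanifold d X).
Hypotheses (M : bistellar_move d i a b X Y) (FZ : stacked_filling d k X Z).
Hypothesis ZE : Z = filling k X.

Let Z' := Z `|` fpowerset (a `|` b).
Let E : exchange X Y a b. Proof. exact: move_exchange NX M. Qed.
Let cX : simplicial_complex X. Proof. by case: M => -[]. Qed.
Let cb : #|` b| = i.+1. Proof. by case: M => _ _ []. Qed.
Let ca : (#|` a| + #|` b| = d.+2)%N. Proof. by case: M => _ _ []. Qed.
Let ab_disj : [disjoint a & b]. Proof. by case: M => _ []. Qed.
Let card_ab : #|` a `|` b| = d.+2.
Proof.
rewrite -ca -cardfsUI.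
by move: ab_disj; rewrite /fdisjoint => /eqP ->; rewrite cardfs0 addn0.
Qed.
(** [b] has at most [k] elements and is no face of [X], so the filling excludes it. *)
Let bNZ s : b `<=` s -> s \notin Z.
Proof.
move=> bs; apply/negP; rewrite ZE => /(mem_filling_complex _ _ cX)/(_ b bs).
rewrite cb => /(_ ltac:(lia))/(exch_b E); by rewrite fsubset_refl.
Qed.
Let cZ : simplicial_complex Z. Proof. by case: (fill_pure FZ). Qed.

Let Zsub s : s `<=` a `|` b -> (s \in Z) = ~~ (b `<=` s).
Proof.
move=> sab; apply/idP/idP => [|bs]; first by apply: contraL; exact: bNZ.
by apply: (fsubsetP (fill_sub FZ)); exact: (exch_X E).
Qed.

Let cZ' : simplicial_complex Z'.
Proof.
case: cZ => Z0 cl; split; first by rewrite inE Z0.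
move=> s p; rewrite !inE !fpowersetE => /orP[sZ ps|sab ps].
  by rewrite (cl _ _ sZ ps).
by rewrite (fsubset_trans ps sab) orbT.
Qed.

Let fcE s : facets_containing d.+1 Z' s =
  if s `<=` a `|` b then (a `|` b) |` facets_containing d.+1 Z s
  else facets_containing d.+1 Z s.
Proof.
have h f : f \in facets_containing d.+1 Z' s =
    (f \in facets_containing d.+1 Z s) || (f == a `|` b) && (s `<=` a `|` b).
  rewrite !in_facets_containing !inE fpowersetE.
  case: (eqVneq f (a `|` b)) => [->|fab] /=.
    by rewrite fsubset_refl orbT card_ab eqxx /= orbC; case: (s `<=` _); rewrite ?orbF ?andbF.
  rewrite orbF; case: (f \in Z) => //=.
  case fsub : (f `<=` a `|` b) => //=; apply/negbTE; rewrite negb_and.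
  apply/orP; left; apply: contra fab => /eqP cf.
  by rewrite eqEfcard fsub cf card_ab /=.
apply/fsetP => f; rewrite h; case: ifP => _; rewrite ?andbF ?orbF //.
by rewrite andbT orbC 2!inE.
Qed.

Let abN s : a `|` b \notin facets_containing d.+1 Z s.
Proof.
by rewrite in_facets_containing (negPf (bNZ (fsubsetUr _ _))).
Qed.

Let card_fc s : #|` facets_containing d.+1 Z' s| =
  ((s `<=` a `|` b)%fset + #|` facets_containing d.+1 Z s|)%N.
Proof. by rewrite fcE; case: ifP => // _; rewrite cardfsU1 abN. Qed.

Let fc0 r : r \notin Z -> #|` facets_containing d.+1 Z r| = 0.
Proof.
move=> rZ; apply/eqP; rewrite cardfs_eq0; apply/eqP/fsetP => f.
rewrite in_facets_containing inE; apply/negbTE; apply: contra rZ.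
by move=> /and3P[fZ _ rf]; case: cZ => _ cl; exact: cl rf.
Qed.

Let fc1 r : #|` r| = d.+1 -> r `<=` a `|` b ->
  #|` facets_containing d.+1 Z r| = ~~ (b `<=` r).
Proof.
move=> cr rab; case br : (b `<=` r); first by rewrite fc0 // bNZ.
by apply/eqP; rewrite -(fill_boundary FZ) //; apply: (exch_X E); rewrite ?br.
Qed.

Lemma filling_move : filling k Y = Z'.
Proof.
(* [b] has [i.+1 <= k] elements, and [2 * k <= d] then leaves at least [k.+2] for [a]. *)
rewrite /Z' ZE; apply: filling_exchange; rewrite ?cb //; last lia.
exact: (move_complex NX M).
Qed.

Let pZ' : pure d.+1 Z'.
Proof.
split=> // s; rewrite inE fpowersetE => /orP[sZ|sab].
  have [_ /(_ s sZ)[f + sf]] := fill_pure FZ.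
  rewrite in_facets => /andP[fZ cf]; exists f => //.
  by rewrite in_facets inE fZ cf.
by exists (a `|` b); rewrite // in_facets card_ab eqxx andbT inE fpowersetE fsubset_refl orbT.
Qed.

(** The new simplex is glued along its ridges opposite vertices of [b], which become interior; its
    ridges opposite vertices of [a] replace them in the boundary. *)
Lemma stacked_filling_move : stacked_filling d k Y (filling k Y).
Proof.
rewrite filling_move; split=> //.
- apply: (ShellingMove (fill_shelled FZ) ik (a := a) (b := b)); split.
  + by split=> //; exact: fill_pure FZ.
  + exact: fsubsetUl.
  + by split=> //; rewrite inE fpowersetE ?fsubsetUl ?fsubsetUr orbT.
  + have := fcE fset0; rewrite fsub0set => h.
    have fE W : facets_containing d.+1 W fset0 = facets d.+1 W :> {fset {fset K}}.
      by apply/fsetP => f; rewrite in_facets_containing fsub0set andbT in_facets.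
    rewrite -!fE h; apply/fsetP => f; rewrite in_fsetD in_fset1U in_fset1.
    case: eqVneq => [->|fab] /=; first by rewrite abN.
    by case: (f \in _).
  + apply/fsetP => s; rewrite mem_join_boundary_r // !inE andbC.
    by case sab : (s `<=` a `|` b) => //=; rewrite Zsub.
- move=> r cr rZ'; rewrite card_fc; case rab : (r `<=` a `|` b).
    by rewrite fc1 //; case: (b `<=` r).
  rewrite add0n; apply: (fill_coface FZ) => //.
  by move: rZ'; rewrite inE fpowersetE rab orbF.
- move=> r cr; rewrite card_fc (exchange_mem _ E); case rab : (r `<=` a `|` b).
    rewrite andbF /= fc1 //.
    have [v vab ->] : exists2 v, v \in a `|` b & r = (a `|` b) `\ v.
      by apply: fsubset_cardS; rewrite // card_ab cr.
    rewrite !fsubsetD1 fsubsetUl fsubsetUr /= !negbK.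
    move: vab; rewrite inE; case va : (v \in a) => /=.
      by rewrite (negPf (fdisjointP ab_disj v va)).
    by move=> ->.
  by rewrite andbT orbF add0n (fill_boundary FZ).
(* The ridge opposite a vertex of [b] lies in exactly one old facet [h], which links the new simplex
   to the rest. *)
- have [v vb] : exists v, v \in b by apply/fset0Pn; rewrite -cardfs_gt0 cb.
  have rab : (a `|` b) `\ v `<=` a `|` b by exact: fsubD1set.
  have cr : #|` (a `|` b) `\ v| = d.+1.
    by rewrite cardfsD1_in ?card_ab // inE vb orbT.
  have : #|` facets_containing d.+1 Z ((a `|` b) `\ v)| == 1.
    rewrite fc1 // fsubsetD1 fsubsetUr vb //.
  move=> /cardfs1P[h /fsetP/(_ h)]; rewrite inE eqxx => hF.
  have hF0 : h \in facets_containing d.+1 Z fset0.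
    by move: hF; rewrite !in_facets_containing fsub0set => /and3P[-> ->].
  have hab : #|` h `&` (a `|` b)| = d.+1.
    move: hF; rewrite in_facets_containing => /and3P[hZ /eqP ch rh].
    apply: card_fsetI_ridge cr rh rab => //.
    by apply: contraTneq hZ => ->; exact: bNZ (fsubsetUr _ _).
  move=> T f g; rewrite fcE fsub0set => clT fF gF Tf.
  have inT p q : p \in facets_containing d.+1 Z fset0 ->
      q \in facets_containing d.+1 Z fset0 -> T p -> T q.
    move=> pF qF; apply: (fill_connected FZ) => // p' q' p'F q'F.
    by apply: clT; rewrite in_fset1U ?p'F ?q'F orbT.
  have toh : T f -> T h.
    move: fF; rewrite in_fset1U => /orP[/eqP ->|fF]; last exact: inT.
    apply: clT; rewrite ?in_fset1U ?eqxx ?hF0 ?orbT //.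
    by rewrite fsetIC.
  move: gF; rewrite in_fset1U => /orP[/eqP ->|gF].
    apply: (clT h) => //; last exact: toh.
      by rewrite in_fset1U hF0 orbT.
    by rewrite in_fset1U eqxx.
  by apply: (inT h) => //; exact: toh.
- apply/fsubsetP => s; rewrite (exchange_mem _ E) inE fpowersetE.
  move=> /orP[/andP[/(fsubsetP (fill_sub FZ)) -> _]|/andP[-> _]] //.
  by rewrite orbT.
- move=> s; rewrite inE fpowersetE => sZ' cs.
  (* [s] has at most [d.+1 - k] elements, while [a] has [d.+1 - i] with [i < k]. *)
  have aNs : ~~ (a `<=` s).
    by apply/negP => /fsubset_leq_card; move: ca cs; rewrite cb; lia.
  case/orP: sZ' => [sZ|sab]; last exact: (exch_Y E).
  by apply: (exch_XY E) => //; exact: (fill_stacked FZ).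
Qed.

End Step.

Lemma filling_simplex_boundary k d a : #|` a| = d.+2 -> k <= d ->
  filling k (simplex_boundary a) = simplex a.
Proof.
move=> ca kd; have [[cX _] _ _] := simplex_boundary_normal ca.
apply/fsetP => s; rewrite fpowersetE; apply/idP/idP => [/mem_filling[sV _]|sa].
  apply: fsubset_trans sV _; apply/bigfcupsP => p.
  by rewrite mem_simplex_boundary => /andP[].
apply/(mem_filling_complex _ _ cX) => p ps cp; rewrite mem_simplex_boundary.
rewrite (fsubset_trans ps sa) /=; apply/negP => /fsubset_leq_card.
by rewrite ca; lia.
Qed.

Lemma stacked_filling_simplex_boundary k d a : #|` a| = d.+2 -> k <= d ->
  stacked_filling d k (simplex_boundary a) (simplex a).
Proof.
move=> ca kd.
have fcE r : facets_containing d.+1 (simplex a) r =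
    if r `<=` a then [fset a] else fset0.
  apply/fsetP => f; rewrite in_facets_containing fpowersetE.
  case: ifP => ra; rewrite !inE; last first.
    by apply/negP => /and3P[fa _ /fsubset_trans/(_ fa)]; rewrite ra.
  apply/and3P/eqP => [[fa /eqP cf rf]|->]; last by rewrite fsubset_refl ca ra.
  by apply/eqP; rewrite eqEfcard fa cf ca leqnn.
have c0 : #|` @fset0 {fset K}| = 0 by exact: cardfs0.
split.
- split; first split.
  + by rewrite fpowersetE fsub0set.
  + by move=> s p; rewrite !fpowersetE => sa /fsubset_trans; apply.
  + move=> s; rewrite fpowersetE => sa; exists a => //.
    by rewrite in_facets fpowersetE fsubset_refl ca eqxx.
- exact: ShellingStandard.
- by move=> r _ _; rewrite fcE; case: ifP => _; rewrite ?cardfs1 ?c0.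
- move=> r cr; rewrite fcE mem_simplex_boundary.
  case: ifP => ra; rewrite ?cardfs1 ?c0 //=.
  by apply/negP => /fsubset_leq_card; rewrite cr ca ltnn.
- move=> T f g _; rewrite fcE fsub0set !inE => /eqP -> /eqP -> //.
- by apply/fsubsetP => s; rewrite mem_simplex_boundary fpowersetE => /andP[].
- move=> s; rewrite fpowersetE mem_simplex_boundary => -> /= cs.
  by apply/negP => /fsubset_leq_card; rewrite ca; lia.
Qed.

(* A [k]-stacked filling agrees with [X] up to size [k.+1], so it is contained
   in [filling k X]; a proper set of facets would leave through a ridge which
   lies on the boundary of [B] but in the interior of [filling k X]. *)
Lemma stacked_filling_unique k d X B : 2 * k <= d -> simplicial_complex X ->
  stacked_filling d k X (filling k X) -> pure d X ->
  simplicial_complex B -> boundary d.+1 B = X ->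
  (forall s, s \in B -> #|` s| + k <= d.+1 -> s \in boundary d.+1 B) ->
  filling k X = B.
Proof.
move=> hd cX FX pX cB dB sB.
have BZ : B `<=` filling k X.
  apply/fsubsetP => s sBs; apply/(mem_filling_complex _ _ cX) => p ps cp.
  (* A set of size at most [k.+1] meets the size bound of stackedness because [2 * k <= d]. *)
  by rewrite -dB; apply: sB; [case: cB => _ cl; exact: cl ps|lia].
have rB r : #|` r| = d.+1 -> (r \in X) = (#|` facets_containing d.+1 B r| == 1).
  by move=> cr; rewrite -dB mem_boundary_ridge.
have FBZ r : facets_containing d.+1 B r `<=` facets_containing d.+1 (filling k X) r.
  apply/fsubsetP => f; rewrite !in_facets_containing => /and3P[+ -> ->].
  by move=> /(fsubsetP BZ) ->.
have [[Z0 Zcl] pZ] := fill_pure FX.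
have [f0 f0B] : exists f, f \in facets_containing d.+1 B fset0.
  have [_ /(_ fset0)[|r]] := pX; first by case: cX.
  rewrite in_facets => /andP[rX /eqP cr] _.
  move: rX; rewrite rB // => /cardfs1P[f /fsetP/(_ f)].
  rewrite inE eqxx in_facets_containing => /and3P[fB cf _].
  by exists f; rewrite in_facets_containing fB cf fsub0set.
have inB g : g \in facets_containing d.+1 (filling k X) fset0 -> g \in B.
  move=> gF; have f0F := fsubsetP (FBZ _) _ f0B.
  apply: (fill_connected FX (T := fun c => c \in B) _ f0F gF); last first.
    by move: f0B; rewrite in_facets_containing => /andP[].
  move=> p q; rewrite !in_facets_containing => /and3P[pZZ cp _] /and3P[qZ cq _] cpq pB.
  apply: contrapT => /negP qB.
  have rZ : p `&` q \in filling k X by apply: Zcl pZZ _; exact: fsubsetIl.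
  have pFB : p \in facets_containing d.+1 B (p `&` q).
    by rewrite in_facets_containing pB cp fsubsetIl.
  have qF : q \in facets_containing d.+1 (filling k X) (p `&` q).
    by rewrite in_facets_containing qZ cq fsubsetIr.
  have qFB : q \notin facets_containing d.+1 B (p `&` q).
    by rewrite in_facets_containing (negPf qB).
  have lt : #|` facets_containing d.+1 B (p `&` q)| <
      #|` facets_containing d.+1 (filling k X) (p `&` q)|.
    apply: fproper_ltn_card; rewrite fproperEneq FBZ andbT.
    by apply: contraNneq qFB => ->.
  have gt0 : 0 < #|` facets_containing d.+1 B (p `&` q)|.
    by rewrite cardfs_gt0; apply/fset0Pn; exists p.
  have le2 := fill_coface FX cpq rZ.
  have h1 := rB _ cpq; rewrite (fill_boundary FX cpq) in h1.
  (* The two counts must be one and two, yet for both of them being one is equivalent to the ridge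
     lying in [X]. *)
  move: lt gt0 le2 h1; do 2 case: (#|` _|) => [|[|[|?]]] //.
apply/eqP; rewrite eqEfsubset BZ andbT; apply/fsubsetP => s /pZ[f].
rewrite in_facets => /andP[fZ cf] sf; case: cB => _ cl; apply: cl sf.
by apply: inB; rewrite in_facets_containing fZ cf fsub0set.
Qed.

End Filling.

(** * Cones and flips *)

Section GlobalHomeo.
Local Open Scope classical_set_scope.

(** Both maps are continuous on the whole spaces, so that they compose without recourse to subspace
    topologies. *)
Definition global_homeo (T U : topologicalType) (A : set T) (B : set U) : Prop :=
  exists (f : T -> U) (g : U -> T),
    [/\ continuous f, continuous g,
        forall x, A x -> B (f x) /\ g (f x) = x
      & forall y, B y -> A (g y) /\ f (g y) = y].

Lemma global_homeo_comp (T U W : topologicalType) (A : set T) (B : set U)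
  (C : set W) : global_homeo A B -> global_homeo B C -> global_homeo A C.
Proof.
move=> [f [g [cf cg fA gB]]] [h [k [ch ck hB kC]]]; exists (h \o f), (g \o k); split.
- by move=> x; apply: continuous_comp; [exact: cf|exact: ch].
- by move=> x; apply: continuous_comp; [exact: ck|exact: cg].
- move=> x /fA[Bfx gfx]; have [Ch khx] := hB _ Bfx.
  by split=> //=; rewrite khx.
- move=> y /kC[Bky hky]; have [Ag fgx] := gB _ Bky.
  by split=> //=; rewrite fgx.
Qed.

Lemma global_homeo_sym (T U : topologicalType) (A : set T) (B : set U) :
  global_homeo A B -> global_homeo B A.
Proof. by move=> [f [g [cf cg fA gB]]]; exists g, f. Qed.

Lemma global_homeo_homeomorphic (T U : topologicalType) (A : set T) (B : set U) :
  global_homeo A B -> homeomorphic_sets A B.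
Proof.
by move=> [f [g [cf cg fA gB]]]; exists f, g; split=> //; exact: continuous_subspaceT.
Qed.

End GlobalHomeo.

(** * Continuity of real-valued functions and of maps into the pointwise topology *)

Section Continuity.
Local Open Scope ring_scope.
Variables (R : realType) (T : topologicalType).

Lemma continuous_sum_seq (I : Type) (r : seq I) (F : I -> T -> R) :
  (forall i, continuous (F i)) -> continuous (fun x => \sum_(i <- r) F i x).
Proof.
move=> cF; apply: continuous_big => // x.
exact: add_continuous.
Qed.

Lemma continuous_minr (f g : T -> R) : continuous f -> continuous g ->
  continuous (fun x => Num.min (f x) (g x)).
Proof. by move=> cf cg x; apply: continuous_min; [exact: cf|exact: cg]. Qed.

Lemma continuous_bigmin_seq (I : Type) (r : seq I) (e : R) (F : I -> T -> R) :
  (forall i, continuous (F i)) ->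
  continuous (fun x => \big[Num.min/e]_(i <- r) F i x).
Proof.
move=> cF; elim: r => [|i r IH].
  by under eq_fun do rewrite big_nil; move=> x; exact: cvg_cst.
by under eq_fun do rewrite big_cons; apply: continuous_minr.
Qed.

Lemma continuous_cst (e : R) : continuous (fun _ : T => e).
Proof. by move=> x; exact: cvg_cst. Qed.

Lemma continuous_addr (f g : T -> R) : continuous f -> continuous g ->
  continuous (fun x => f x + g x).
Proof. by move=> cf cg x; apply: cvgD; [exact: cf|exact: cg]. Qed.

Lemma continuous_subr (f g : T -> R) : continuous f -> continuous g ->
  continuous (fun x => f x - g x).
Proof. by move=> cf cg x; apply: cvgB; [exact: cf|exact: cg]. Qed.

Lemma continuous_mulr (f g : T -> R) : continuous f -> continuous g ->
  continuous (fun x => f x * g x).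
Proof. by move=> cf cg x; apply: cvgM; [exact: cf|exact: cg]. Qed.

Variable K : choiceType.

(** The pointwise topology is the supremum of those pulled back along the evaluations, which are
    onto because of the constant functions. *)
Lemma continuous_ptws (f : T -> {ptws K -> R}) :
  (forall v, continuous (fun x => f x v)) -> continuous f.
Proof.
move=> cf x; apply/cvg_sup => v; apply/cvg_image.
  by rewrite eqEsubset; split=> // y _; exists (fun=> y).
move=> W /cf fW; exists ((fun y : K -> R => y v) @^-1` W)%classic => //.
by rewrite eqEsubset; split=> [y [z ? <-]//|y Wy]; exists (fun=> y).
Qed.

End Continuity.

Lemma continuous_eval (R : realType) (K : choiceType) (v : K) :
  continuous (fun x : {ptws K -> R} => x v).
Proof. exact: (@proj_continuous K (fun=> R) v). Qed.

(** * A piecewise linear model of a bistellar move *)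

Section Flip.
Local Open Scope fset_scope.
Local Open Scope ring_scope.
Variables (R : realType) (K : choiceType) (V : {fset K}).
Implicit Types (x y : {ptws K -> R}) (s p : {fset K}) (X Y Z : {fset {fset K}}).

Definition mass x : R := \sum_(v <- V) x v.

Definition supported s x : Prop :=
  (forall v, 0 <= x v) /\ forall v, v \notin s -> x v = 0.

Lemma supportedW s p x : s `<=` p -> supported s x -> supported p x.
Proof.
by move=> sp [x0 xN]; split=> // v vp; apply: xN; apply: contra vp; exact: fsubsetP.
Qed.

(* The cone over the carrier of [X]: the apex coordinate is [1 - mass x]. *)
Definition cone X : set {ptws K -> R} :=
  [set x | exists2 s, s \in X & supported s x /\ mass x <= 1]%classic.

Definition cone_base X : set {ptws K -> R} :=
  [set x | exists2 s, s \in X & supported s x /\ mass x = 1]%classic.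

(* In use all coordinates are at most [1], so that the default value [1] is
   the minimum only when it is attained or when [s] is empty. *)
Definition lowest s x : R := \big[Num.min/1]_(v <- s) x v.

(** The flag [w] tells whether the apex counts as one more vertex of [s]. *)
Definition lowest_apex (w : bool) s x : R :=
  Num.min (lowest s x) (if w then 1 - mass x else 1).

Lemma mass_supported s x : s `<=` V -> supported s x -> mass x = \sum_(v <- s) x v.
Proof.
move=> sV [_ x0]; rewrite /mass; symmetry; apply: big_fset_incl => // v _ vs.
exact: x0.
Qed.

Lemma cone_base_carrier X : (forall s, s \in X -> s `<=` V) ->
  cone_base X = geometric_carrier X.
Proof.
move=> XV; apply/seteqP; split=> x [s sX].
  move=> [xs x1]; exists s => //; case: (xs) => x0 xN; split=> //.
  by rewrite -(mass_supported (XV _ sX) xs).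
by move=> [x0 xN x1]; exists s => //; split; rewrite // (mass_supported (XV _ sX)).
Qed.

Lemma lowest_le s x v : v \in s -> lowest s x <= x v.
Proof.
rewrite /lowest => vs; have : v \in (s : seq K) by [].
elim: (s : seq K) => //= u r IH; rewrite inE big_cons ge_min.
by move=> /orP[/eqP ->|/IH ->]; rewrite ?lexx ?orbT.
Qed.

Lemma lowest_ge s x t : t <= 1 -> (forall v, v \in s -> t <= x v) -> t <= lowest s x.
Proof.
move=> t1 h; rewrite /lowest big_seq.
by elim/big_ind: _ => // u v; rewrite le_min => -> ->.
Qed.

Lemma lowest_attained s x : s != fset0 -> (forall v, x v <= 1) ->
  exists2 v, v \in s & x v = lowest s x.
Proof.
move=> /fset0Pn[u us] x1.
have : lowest s x = 1 \/ exists2 v, v \in s & x v = lowest s x.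
  rewrite /lowest big_seq; elim/big_ind: _ => [|y z hy hz|v vs]; [by left| |by right; exists v].
  by rewrite /Num.min; case: ifP.
(* If the minimum is the default [1], every coordinate in [s] attains it, being at most [1]. *)
case=> // l1; exists u => //; apply/eqP; rewrite eq_le lowest_le // l1.
by rewrite x1.
Qed.

Lemma continuous_lowest s : continuous (lowest s).
Proof. by apply: continuous_bigmin_seq => v; exact: continuous_eval. Qed.

Lemma continuous_mass : continuous mass.
Proof. by apply: continuous_sum_seq => v; exact: continuous_eval. Qed.

Lemma continuous_lowest_apex w s : continuous (lowest_apex w s).
Proof.
apply: continuous_minr; first exact: continuous_lowest.
case: w.
  by apply: continuous_subr; [exact: continuous_cst|exact: continuous_mass].
exact: continuous_cst.
Qed.

(** The cone over the full simplex on [V], where coordinates are at most [1], as the default value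
    in [lowest] requires. *)
Definition good x : Prop := supported V x /\ mass x <= 1.

Lemma good_le1 x v : good x -> x v <= 1.
Proof.
move=> [[x0 xN] x1]; have [vV|/xN ->] := boolP (v \in V); last exact: ler01.
apply: le_trans x1; rewrite /mass (big_fsetD1 v) //= lerDl.
by apply: sumr_ge0.
Qed.

Lemma lowest_ge0 s x : good x -> 0 <= lowest s x.
Proof. by move=> [[x0 _] _]; apply: lowest_ge. Qed.

Lemma lowest_eq0 s x v : good x -> v \in s -> x v = 0 -> lowest s x = 0.
Proof.
move=> gx vs xv; apply/eqP; rewrite eq_le lowest_ge0 // andbT -xv.
exact: lowest_le.
Qed.

Lemma lowest_apex_ge0 w s x : good x -> 0 <= lowest_apex w s x.
Proof.
move=> gx; rewrite /lowest_apex le_min lowest_ge0 //=.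
by case: w => //; rewrite subr_ge0; case: gx.
Qed.

Lemma lowest_apex_attained (w : bool) s x : good x -> w || (s != fset0) ->
  (exists2 v, v \in s & x v = lowest_apex w s x) \/
  (w /\ 1 - mass x = lowest_apex w s x).
Proof.
move=> gx; have [->|s0] := eqVneq s fset0.
  rewrite /= orbF => ->; right; split=> //.
  have -> : lowest_apex true fset0 x = Num.min 1 (1 - mass x).
    by rewrite /lowest_apex /lowest big_seq big_pred0 // => v; rewrite inE.
  rewrite min_r // gerBl.
  by apply: sumr_ge0 => v _; case: gx => -[].
have [v vs vl] := lowest_attained s0 (fun v => good_le1 v gx).
rewrite /lowest_apex /Num.min; case: ifP => lt _; first by left; exists v.
case: w lt => lt; [by right|left; exists v => //].
by apply/eqP; rewrite eq_le good_le1 // vl leNgt lt.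
Qed.

Lemma lowest_apex_le w s x v : v \in s -> lowest_apex w s x <= x v.
Proof. by move=> vs; rewrite /lowest_apex ge_min lowest_le. Qed.

Lemma lowest_apex_le_apex s x : lowest_apex true s x <= 1 - mass x.
Proof. by rewrite /lowest_apex ge_min lexx orbT. Qed.

Lemma lowest_apex_eq (w : bool) s x t : good x ->
  (forall v, v \in s -> t <= x v) -> (w -> t <= 1 - mass x) ->
  (exists2 v, v \in s & x v = t) \/ (w /\ 1 - mass x = t) ->
  lowest_apex w s x = t.
Proof.
move=> gx ts tw h; apply/eqP; rewrite eq_le; apply/andP; split.
  case: h => [[v vs <-]|[ww <-]]; first exact: lowest_apex_le.
  by move: ww; case: w tw => // _ _; exact: lowest_apex_le_apex.
have t1 : t <= 1.
  case: h => [[v vs <-]|[ww <-]]; first exact: good_le1.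
  by rewrite gerBl; apply: sumr_ge0 => v _; case: gx => -[].
by rewrite /lowest_apex le_min lowest_ge //=; case: w tw {h} => // /(_ isT).
Qed.

Section OneFlip.
Variables (a b : {fset K}) (w : bool).
Hypotheses (aV : a `<=` V) (bV : b `<=` V) (ab : [disjoint a & b]).
Hypotheses (a0 : a != fset0) (wb : w || (b != fset0)).

(** With this ratio the mass taken evenly from [a] equals the mass given evenly to [b] and, if [w],
    to the apex. *)
Let c : R := #|` a|%:R / (#|` b| + w)%:R.

Let den_gt0 : 0 < (#|` b| + w)%:R :> R.
Proof. by rewrite ltr0n addn_gt0 cardfs_gt0 lt0b orbC. Qed.

Let c_gt0 : 0 < c.
Proof. by rewrite divr_gt0 // ltr0n cardfs_gt0. Qed.

Let cE : #|` a|%:R = c * (#|` b|%:R + w%:R).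
Proof. by rewrite /c natrD divfK // -natrD lt0r_neq0. Qed.

(* Moves mass from [a] to [b] and, if [w], to the apex: a piecewise linear map
   from the join of a with the boundary of (b with the apex) onto the join of
   the boundary of a with (b with the apex), fixing their common boundary. *)
Definition flip x : {ptws K -> R} := fun v =>
  x v + lowest a x * (if v \in a then -1 else if v \in b then c else 0).

(** [flip] with the roles of [a] and of [b] with its possible apex exchanged, whence the inverse
    ratio. *)
Definition unflip x : {ptws K -> R} := fun v =>
  x v + lowest_apex w b x * (if v \in a then c^-1 else if v \in b then -1 else 0).

Lemma continuous_flip : continuous flip.
Proof.
apply: continuous_ptws => v; apply: continuous_addr; first exact: continuous_eval.
by apply: continuous_mulr; [exact: continuous_lowest|exact: continuous_cst].
Qed.

Lemma continuous_unflip : continuous unflip.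
Proof.
apply: continuous_ptws => v; apply: continuous_addr; first exact: continuous_eval.
by apply: continuous_mulr; [exact: continuous_lowest_apex|exact: continuous_cst].
Qed.

Lemma sum_indicators (p q : R) :
  \sum_(v <- V) (if v \in a then p else if v \in b then q else 0) =
  #|` a|%:R * p + #|` b|%:R * q.
Proof.
have ind s (r : R) : s `<=` V -> \sum_(v <- V) (if v \in s then r else 0) = #|` s|%:R * r.
  move=> sV; rewrite -(big_fset_incl _ sV) => [|v _ /negPf -> //].
  rewrite (eq_big_seq (fun=> r)) => [|v -> //].
  by rewrite big_const_seq count_predT iter_addr_0 mulr_natl.
rewrite -(ind a p aV) -(ind b q bV) -big_split /=; apply: eq_bigr => v _.
have := fdisjointP ab v; case: (v \in a) => [/(_ isT)/negPf ->|_].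
  by rewrite addr0.
by rewrite add0r.
Qed.

Lemma mass_flip x : mass (flip x) = mass x - w%:R * (c * lowest a x).
Proof.
rewrite /mass /flip big_split /= -mulr_sumr sum_indicators cE.
by rewrite /mass; ring.
Qed.

Lemma mass_unflip x : mass (unflip x) = mass x + w%:R * lowest_apex w b x.
Proof.
rewrite /mass /unflip big_split /= -mulr_sumr sum_indicators cE.
have c0 : c != 0 by rewrite lt0r_neq0.
by rewrite /mass; field.
Qed.

Lemma flip_good x : good x -> good (flip x).
Proof.
move=> gx; have l0 := lowest_ge0 a gx; have c0 := c_gt0.
have [[x0 xN] x1] := gx; split; [split|] => [v|v vV|].
- rewrite /flip; case va : (v \in a); first by have := lowest_le x va; lra.
  case: (v \in b); last by rewrite mulr0 addr0.
  by rewrite addr_ge0 // mulr_ge0 // ltW.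
- rewrite /flip (negPf (contra (fsubsetP aV v) vV)) (negPf (contra (fsubsetP bV v) vV)).
  by rewrite xN // mulr0 addr0.
- rewrite mass_flip; apply: le_trans x1; rewrite gerBl.
  by rewrite mulr_ge0 // mulr_ge0 // ltW.
Qed.

Lemma unflip_good x : good x -> good (unflip x).
Proof.
move=> gx; have l0 := lowest_apex_ge0 w b gx; have c0 := c_gt0.
have [[x0 xN] x1] := gx; split; [split|] => [v|v vV|].
- rewrite /unflip; case va : (v \in a).
    by rewrite addr_ge0 // mulr_ge0 // invr_ge0 ltW.
  case vb : (v \in b); last by rewrite mulr0 addr0.
  by have := lowest_apex_le w x vb; lra.
- rewrite /unflip (negPf (contra (fsubsetP aV v) vV)) (negPf (contra (fsubsetP bV v) vV)).
  by rewrite xN // mulr0 addr0.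
- rewrite mass_unflip; case: w l0 => l0; last by rewrite mul0r addr0.
  by have := lowest_apex_le_apex b x; rewrite mul1r; lra.
Qed.

Let a_notin_b v : v \in b -> (v \in a) = false.
Proof. by move=> vb; apply/negP => /(fdisjointP ab); rewrite vb. Qed.

Lemma lowest_flip x : good x -> lowest a (flip x) = 0.
Proof.
move=> gx; have [v va vl] := lowest_attained a0 (fun v => good_le1 v gx).
apply: (lowest_eq0 (flip_good gx) va).
by rewrite /flip va vl; ring.
Qed.

Lemma lowest_apex_unflip x : good x -> lowest_apex w b (unflip x) = 0.
Proof.
move=> gx; have gu := unflip_good gx; apply: lowest_apex_eq => //.
- by move=> v _; case: gu => -[].
- by move=> _; rewrite subr_ge0; case: gu.
case: (lowest_apex_attained gx wb) => [[v vb vl]|[ww vl]].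
  by left; exists v; rewrite // /unflip a_notin_b // vb vl; ring.
by right; split=> //; rewrite mass_unflip -vl ww mul1r; ring.
Qed.

(** All coordinates in [b], and the apex coordinate if [w], rise by the same amount from a minimum
    of [0]. The new minimum thus records how much [unflip] has to move back. *)
Lemma lowest_apex_flip x : good x -> lowest_apex w b x = 0 ->
  lowest_apex w b (flip x) = c * lowest a x.
Proof.
move=> gx lx; have gf := flip_good gx; have [[x0 _] x1] := gx.
apply: lowest_apex_eq => //.
- by move=> v vb; rewrite /flip a_notin_b // vb mulrC lerDr.
- move=> ww; rewrite mass_flip ww mul1r; lra.
case: (lowest_apex_attained gx wb) => [[v vb vl]|[ww vl]].
  by left; exists v; rewrite // /flip a_notin_b // vb vl lx add0r mulrC.
by right; split=> //; rewrite mass_flip ww mul1r; move: vl; rewrite lx; lra.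
Qed.

Lemma lowest_unflip x : good x -> lowest a x = 0 ->
  lowest a (unflip x) = c^-1 * lowest_apex w b x.
Proof.
move=> gx lx; have gu := unflip_good gx; have [[x0 _] x1] := gx.
have [v va vl] := lowest_attained a0 (fun v => good_le1 v gx).
have e : unflip x v = c^-1 * lowest_apex w b x.
  by rewrite /unflip va vl lx add0r mulrC.
apply/eqP; rewrite eq_le -{1}e lowest_le //=; apply: lowest_ge.
  by rewrite -e good_le1.
by move=> u ua; rewrite /unflip ua mulrC lerDr.
Qed.

Lemma flipK x : good x -> lowest_apex w b x = 0 -> unflip (flip x) = x.
Proof.
move=> gx lx; apply/funext => v; rewrite /unflip lowest_apex_flip // /flip.
have c0 : c != 0 by rewrite lt0r_neq0.
case: (v \in a); first by field.
by case: (v \in b); ring.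
Qed.

Lemma unflipK x : good x -> lowest a x = 0 -> flip (unflip x) = x.
Proof.
move=> gx lx; apply/funext => v; rewrite /flip lowest_unflip // /unflip.
have c0 : c != 0 by rewrite lt0r_neq0.
case: (v \in a); first by ring.
by case: (v \in b); [field|ring].
Qed.

Lemma flip_id x : lowest a x = 0 -> flip x = x.
Proof. by move=> l0; apply/funext => v; rewrite /flip l0 mul0r addr0. Qed.

Lemma unflip_id x : lowest_apex w b x = 0 -> unflip x = x.
Proof. by move=> l0; apply/funext => v; rewrite /unflip l0 mul0r addr0. Qed.

Lemma flip_supported s x : good x -> a `|` b `<=` s -> supported s x ->
  supported s (flip x).
Proof.
move=> gx; rewrite fsubUset => /andP[as_ bs] [x0 xN].
have [[f0 _] _] := flip_good gx; split=> // v vs.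
rewrite /flip (negPf (contra (fsubsetP as_ v) vs)) (negPf (contra (fsubsetP bs v) vs)).
by rewrite xN // mulr0 addr0.
Qed.

Lemma unflip_supported s x : good x -> a `|` b `<=` s -> supported s x ->
  supported s (unflip x).
Proof.
move=> gx; rewrite fsubUset => /andP[as_ bs] [x0 xN].
have [[f0 _] _] := unflip_good gx; split=> // v vs.
rewrite /unflip (negPf (contra (fsubsetP as_ v) vs)) (negPf (contra (fsubsetP bs v) vs)).
by rewrite xN // mulr0 addr0.
Qed.

Variables (X Y : {fset {fset K}}).
Hypotheses (E : exchange X Y a b).
Hypotheses (clX : forall s p, s \in X -> p `<=` s -> p \in X).
Hypotheses (clY : forall s p, s \in Y -> p `<=` s -> p \in Y).
Hypotheses (XV : forall s, s \in X -> s `<=` V) (YV : forall s, s \in Y -> s `<=` V).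

(* For [w], the cone over [X] with the simplex [a `|` b] glued to its base. *)
Definition flip_domain : set {ptws K -> R} :=
  [set x | cone X x \/ w /\ (supported (a `|` b)%fset x /\ mass x = 1)]%classic.

Let cone_good Z x : (forall s, s \in Z -> s `<=` V) -> cone Z x -> good x.
Proof. by move=> ZV [s sZ [sx x1]]; split=> //; exact: supportedW (ZV _ sZ) sx. Qed.

Let abV : a `|` b `<=` V. Proof. by rewrite fsubUset aV. Qed.

Let dom_good x : flip_domain x -> good x.
Proof.
case=> [|[_ [sx x1]]]; first exact: cone_good.
by split; [exact: supportedW sx|rewrite x1].
Qed.

Let support Z x : (forall s p, s \in Z -> p `<=` s -> p \in Z) -> cone Z x ->
  exists2 s, s \in Z & supported s x /\ forall v, v \in s -> x v != 0.
Proof.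
move=> clZ [s sZ [[x0 xN] x1]]; exists [fset v in s | x v != 0].
  by apply: clZ sZ _; apply/fsubsetP => v; rewrite !inE => /andP[].
split; last by move=> v; rewrite !inE => /andP[].
split=> // v; rewrite !inE negb_and negbK => /orP[/xN//|/eqP//].
Qed.

(** A face of [X] misses a vertex of [b], and on the glued simplex the apex coordinate is zero. *)
Lemma flip_domain_apex x : flip_domain x -> lowest_apex w b x = 0.
Proof.
move=> dx; have gx := dom_good dx; apply: lowest_apex_eq => //.
- by move=> v _; case: gx => -[].
- by move=> _; rewrite subr_ge0; case: gx.
case: dx => [[s sX [[_ xN] _]]|[ww [_ x1]]]; last by right; rewrite x1 subrr.
by left; have /fsubsetPn[v vb /xN xv] := exch_b E sX; exists v.
Qed.

Lemma cone_lowest x : cone Y x -> lowest a x = 0.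
Proof.
move=> cx; have gx := cone_good YV cx; case: cx => s sY [[_ xN] _].
have /fsubsetPn[v va /xN xv] := exch_a E sY; exact: lowest_eq0 xv.
Qed.

Let supportedD s v x : supported s x -> x v = 0 -> supported (s `\ v) x.
Proof.
move=> [x0 xN] xv; split=> // u; rewrite !inE negb_and negbK.
by move=> /orP[/eqP -> //|/xN].
Qed.

Let sub_aN s v : v \in a -> ~~ (a `<=` s `\ v).
Proof. by move=> va; rewrite fsubsetD1 va andbF. Qed.

Let sub_bN s v : v \in b -> ~~ (b `<=` s `\ v).
Proof. by move=> vb; rewrite fsubsetD1 vb andbF. Qed.

Let flip_ab x : good x -> supported (a `|` b) x -> cone Y (flip x).
Proof.
move=> gx sx; have gf := flip_good gx.
have [v va vl] := lowest_attained a0 (fun v => good_le1 v gf).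
exists ((a `|` b) `\ v); first by apply: (exch_Y E); [exact: fsubD1set|exact: sub_aN].
split; last by case: gf.
by apply: supportedD; [exact: flip_supported|rewrite vl lowest_flip].
Qed.

(** A face of [X] containing [a] lies in the simplex on [a] and [b], where [flip_ab] applies; on any
    other face some coordinate in [a] vanishes and [flip] is the identity. *)
Lemma flip_cone x : flip_domain x -> cone Y (flip x).
Proof.
move=> dx; have gx := dom_good dx.
case: dx => [cx|[ww [sx _]]]; last exact: flip_ab.
have [s sX [sx xpos]] := support clX cx.
case as_ : (a `<=` s).
  by apply: flip_ab => //; apply: supportedW sx; exact: (exch_star_a E).
have /fsubsetPn[v va vs] := negbT as_.
rewrite flip_id; last by apply: (lowest_eq0 gx va); case: sx => _; exact.
by exists s; [apply: (exch_XY E); rewrite ?as_|split; case: gx].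
Qed.

Lemma unflip_domain x : cone Y x -> flip_domain (unflip x).
Proof.
move=> cx; have gx := cone_good YV cx; have [s sY [sx xpos]] := support clY cx.
case bs : (b `<=` s); last first.
  have /fsubsetPn[v vb vs] := negbT bs.
  rewrite unflip_id.
    by left; exists s; [apply: (exch_YX E); rewrite ?bs|split; case: gx].
  apply: lowest_apex_eq => //.
  - by move=> u _; case: gx => -[].
  - by move=> _; rewrite subr_ge0; case: gx.
  - by left; exists v => //; case: sx => _; exact.
have sab := exch_star_b E sY bs.
have gu := unflip_good gx.
have su := unflip_supported gx (fsubset_refl _) (supportedW sab sx).
(* Some coordinate in [b] or at the apex is now zero: the first puts the point in the cone over [X],
   the second on the glued simplex. *)
case: (lowest_apex_attained gu wb); rewrite lowest_apex_unflip // => -[].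
  move=> v vb uv; left; exists ((a `|` b) `\ v).
    by apply: (exch_X E); [exact: fsubD1set|exact: sub_bN].
  by split; [exact: supportedD|case: gu].
move=> ww u1; right; split=> //; split=> //.
by apply/eqP; rewrite eq_sym -subr_eq0 u1.
Qed.

Lemma flip_domainK x : flip_domain x -> unflip (flip x) = x.
Proof. by move=> dx; rewrite flipK //; [exact: dom_good|exact: flip_domain_apex]. Qed.

Lemma cone_unflipK y : cone Y y -> flip (unflip y) = y.
Proof. by move=> cy; rewrite unflipK //; [exact: cone_good cy|exact: cone_lowest]. Qed.

Lemma flip_homeo : global_homeo flip_domain (cone Y).
Proof.
exists flip, unflip; split; [exact: continuous_flip|exact: continuous_unflip| |].
- by move=> x dx; split; [exact: flip_cone|exact: flip_domainK].
- by move=> y cy; split; [exact: unflip_domain|exact: cone_unflipK].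
Qed.

End OneFlip.
End Flip.

(** * Homeomorphisms from fillings to cones *)

Section ConeFilling.
Local Open Scope fset_scope.
Local Open Scope ring_scope.
Variables (R : realType) (K : choiceType) (V : {fset K}).
Implicit Types (x y : {ptws K -> R}) (s p a b : {fset K}) (X Y Z : {fset {fset K}}).

(* A homeomorphism from the carrier of [Z] onto the cone over [X], given by
   maps of the whole space: [phi] fixes a simplex that meets [Z] only in [X],
   so that it extends by the identity over a simplex glued to [Z] along [X]. *)
Definition cone_filling X Z : Prop :=
  exists phi psi : {ptws K -> R} -> {ptws K -> R},
    [/\ continuous phi /\ continuous psi,
        forall x, cone_base V Z x -> cone V X (phi x) /\ psi (phi x) = x,
        forall y, cone V X y -> cone_base V Z (psi y) /\ phi (psi y) = y,
        forall s x, good V x -> supported s x ->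
          (forall p, p `<=` s -> p \in Z -> p \in X) -> phi x = x
      & forall x, good V x -> mass V x = 1 -> psi x = x].

(** [phi] sends the carrier of [Z] to the cone over [X] and fixes the glued simplex, which meets [Z]
    only in [X]. Hence it sends the enlarged carrier onto [flip_domain], and [flip] with apex
    carries this onto the cone over [Y]. *)
Lemma cone_filling_exchange X Y Z a b : a `|` b `<=` V -> [disjoint a & b] ->
  a != fset0 -> exchange X Y a b ->
  (forall s p, s \in X -> p `<=` s -> p \in X) ->
  (forall s p, s \in Y -> p `<=` s -> p \in Y) ->
  (forall s, s \in X -> s `<=` V) -> (forall s, s \in Y -> s `<=` V) ->
  (forall s, s \in Z -> s `<=` V) ->
  (forall s, s \in Z -> ~~ (b `<=` s)) ->
  (forall s, s `<=` a `|` b -> s \in Z -> s \in X) ->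
  cone_filling X Z -> cone_filling Y (Z `|` fpowerset (a `|` b)).
Proof.
move=> abV ab a0 E clX clY XV YV ZV bZ abZ.
move=> [phi [psi [[cphi cpsi] phiP psiP phi_id psi_id]]].
have [aV bV] : a `<=` V /\ b `<=` V by move: abV; rewrite fsubUset => /andP.
have wb : true || (b != fset0) by [].
have goodV s x : s `<=` V -> supported s x -> mass V x <= 1 -> good V x.
  by move=> sV sx x1; split=> //; exact: supportedW sx.
exists (flip a b true \o phi), (psi \o unflip V a b true); split.
- split=> x; apply: continuous_comp; [exact: cphi|exact: continuous_flip| |exact: cpsi].
  exact: continuous_unflip.
- have dom x : flip_domain V a b true X x -> psi (unflip V a b true (flip a b true x)) = psi x.
    by move=> dx; rewrite (flip_domainK aV bV ab a0 wb E XV dx).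
  have cone_flip x : flip_domain V a b true X x -> cone V Y (flip a b true x).
    by move=> dx; exact: (flip_cone aV bV ab a0 wb E clX XV dx).
  move=> x [s]; rewrite inE fpowersetE => sZ' [sx x1] /=.
  have [sZ|sZ] := boolP (s \in Z).
    have [cx psix] : cone V X (phi x) /\ psi (phi x) = x by apply: phiP; exists s.
    have dx : flip_domain V a b true X (phi x) by left.
    by split; [exact: cone_flip|rewrite dom].
  have sab : s `<=` a `|` b by move: sZ'; rewrite (negPf sZ).
  have sabx := supportedW sab sx.
  have gx : good V x by apply: goodV sabx _; rewrite ?x1.
  rewrite (phi_id _ _ gx sabx abZ).
  have dx : flip_domain V a b true X x by right.
  by split; [exact: cone_flip|rewrite dom // psi_id].
- move=> y cy /=; have dy := unflip_domain aV bV ab a0 wb E clY YV cy.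
  have Ky := cone_unflipK aV bV ab a0 wb E YV cy.
  case: dy => [cx|[_ [sx x1]]].
    have [[s sZ [sx x1]] phix] := psiP _ cx.
    by split; [exists s => //; rewrite inE sZ|rewrite phix].
  have gx : good V (unflip V a b true y) by apply: goodV sx _; rewrite ?x1.
  rewrite psi_id // (phi_id _ _ gx sx abZ); split=> //.
  by exists (a `|` b) => //; rewrite inE fpowersetE fsubset_refl orbT.
- move=> s x gx sx h /=.
  have -> : phi x = x.
    apply: (phi_id s) => // p ps pZ; apply: (exch_YX E); last exact: bZ.
    by apply: h => //; rewrite inE pZ.
  (* [a] is a face of the new filling but not of [Y], so [s] cannot contain it and [flip] fixes
     [x]. *)
  have /fsubsetPn[v va vs] : ~~ (a `<=` s).
    apply/negP => as_; have /h : a \in Z `|` fpowerset (a `|` b).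
      by rewrite inE fpowersetE fsubsetUl orbT.
    by move=> /(_ as_)/(exch_a E); rewrite fsubset_refl.
  by rewrite flip_id //; apply: (lowest_eq0 gx va); case: sx => _; exact.
- move=> x gx x1 /=; rewrite unflip_id ?psi_id //.
  apply: lowest_apex_eq => //; first by move=> v _; case: gx => -[].
    by rewrite x1 subrr.
  by right; rewrite x1 subrr.
Qed.

(** This is the previous construction started from nothing: the simplex is glued to the empty
    complex with [b] empty, and [flip] moves mass from [a] to the apex alone. *)
Lemma cone_filling_simplex_boundary a : a != fset0 -> a `<=` V ->
  cone_filling (simplex_boundary a) (simplex a).
Proof.
move=> a0 aV.
have -> : simplex a = fset0 `|` fpowerset (a `|` fset0) by rewrite fset0U fsetU0.
have E : exchange fset0 (simplex_boundary a) a fset0.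
  by split=> s; rewrite ?in_fset0 ?fsetU0 ?fsub0set ?mem_simplex_boundary //;
    [case/andP|case/andP|move=> -> ->].
apply: (@cone_filling_exchange fset0) => //.
- by rewrite fsetU0.
- exact: fdisjointX0.
- move=> s p; rewrite !mem_simplex_boundary => /andP[sa asN] ps.
  rewrite (fsubset_trans ps sa) /=; apply: contra asN => /fsubset_trans; exact.
- by move=> s; rewrite mem_simplex_boundary => /andP[sa _]; exact: fsubset_trans sa aV.
- exists id, id; split=> //.
  + by split=> x; exact: cvg_id.
  + by move=> x [s]; rewrite inE.
  + by move=> x [s]; rewrite inE.
Qed.

End ConeFilling.

(** * Cones as balls *)

Section Radial.
Local Open Scope ring_scope.
Variables (R : realType) (n : nat).
Implicit Types (u : 'rV[R]_n) (p q : 'rV[R]_n -> R).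

(** The set where [p] is at most [1] is then a bounded neighbourhood of the origin, star-shaped
    about it. *)
Record gauge p : Prop := Gauge {
  gauge_cont : continuous p;
  gauge_hom : forall t u, 0 <= t -> p (t *: u) = t * p u;
  gauge_norm : forall u, `|u| <= p u }.

(** Rescales each ray so that [q] of the image is [p] of the argument; at the origin the value is
    [0] whatever the quotient. *)
Definition radial p q u : 'rV[R]_n := (p u / q u) *: u.

Lemma gauge0 p : gauge p -> p 0 = 0.
Proof. by move=> gp; rewrite -(scale0r 0) (gauge_hom gp) // mul0r. Qed.

Lemma gauge_gt0 p u : gauge p -> u != 0 -> 0 < p u.
Proof. by move=> gp u0; apply: lt_le_trans (gauge_norm gp u); rewrite normr_gt0. Qed.

Lemma gauge_ge0 p u : gauge p -> 0 <= p u.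
Proof. by move=> gp; apply: le_trans (gauge_norm gp u). Qed.

(** Away from the origin this is a quotient of continuous functions. At the origin the norm of the
    image is at most [p], because [q] dominates the norm. *)
Lemma continuous_radial p q : gauge p -> gauge q -> continuous (radial p q).
Proof.
move=> gp gq u; have [->|u0] := eqVneq u 0; last first.
  have qu0 : q u != 0 by rewrite gt_eqF // gauge_gt0.
  apply: (@continuousZ R _ _ (fun u => p u / q u) id u); last exact: cvg_id.
  apply: (@continuousM R _ p (fun u => (q u)^-1)); first exact: (gauge_cont gp).
  by apply: continuousV => //; exact: (gauge_cont gq).
have r0 : radial p q 0 = 0 by rewrite /radial scaler0.
suff : (radial p q x @[x --> (0 : 'rV[R]_n)] --> (0 : 'rV[R]_n))%classic.
  by rewrite -{2}r0; exact.
apply/(cvgr0Pnorm_lt (FF := nbhs_filter (0 : 'rV[R]_n))) => e e0.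
have : (p x @[x --> (0 : 'rV[R]_n)] --> (0 : R))%classic.
  by rewrite -(gauge0 gp); exact: (gauge_cont gp).
move=> /(cvgr0_norm_lt (FF := nbhs_filter (0 : 'rV[R]_n)))/(_ e e0); apply: filterS => x; apply: le_lt_trans.
have [->|x0] := eqVneq x 0; first by rewrite r0 normr0.
have qx := gauge_gt0 gq x0.
rewrite /radial normrZ normrM normfV (gtr0_norm qx) mulrAC ler_pdivrMr // ler_wpM2l //.
exact: gauge_norm.
Qed.

Lemma gauge_radial p q u : gauge p -> gauge q -> q (radial p q u) = p u.
Proof.
move=> gp gq; have [->|u0] := eqVneq u 0.
  by rewrite /radial scaler0 !gauge0.
rewrite /radial (gauge_hom gq) ?divr_ge0 ?gauge_ge0 // divfK //.
by rewrite gt_eqF // gauge_gt0.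
Qed.

Lemma radialK p q u : gauge p -> gauge q -> radial q p (radial p q u) = u.
Proof.
move=> gp gq; have [->|u0] := eqVneq u 0; first by rewrite /radial !scaler0.
have p0 := gauge_gt0 gp u0; have q0 := gauge_gt0 gq u0.
rewrite {1}/radial gauge_radial // /radial (gauge_hom gp) ?divr_ge0 ?gauge_ge0 //.
rewrite scalerA -[RHS]scale1r; congr (_ *: _); field.
by rewrite !gt_eqF.
Qed.

Lemma gauge_homeo p q : gauge p -> gauge q ->
  global_homeo [set u | p u <= 1]%classic [set u | q u <= 1]%classic.
Proof.
move=> gp gq; exists (radial p q), (radial q p); split.
- exact: continuous_radial.
- exact: continuous_radial.
- by move=> u /= pu; rewrite gauge_radial // radialK.
- by move=> u /= qu; rewrite gauge_radial // radialK.
Qed.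

Lemma mx_norm_le u e : 0 <= e -> (forall j, `|u 0 j| <= e) -> `|u| <= e.
Proof.
move=> e0 h; rewrite [leLHS]/Num.norm /= mx_normrE; apply: bigmax_le => // -[i j] _ /=.
by rewrite ord1.
Qed.

Definition euclid u : R := Num.sqrt (\sum_j u 0 j ^+ 2).

Lemma euclid_gauge : gauge euclid.
Proof.
split.
- move=> u; apply: (@continuous_comp _ _ _ (fun u => \sum_j u 0 j ^+ 2) Num.sqrt).
    apply: (@continuous_sum_seq R _ _ _ (fun j (u : 'rV[R]_n) => u 0 j ^+ 2)) => j.
    by apply: continuous_mulr; exact: coord_continuous.
  exact: sqrt_continuous.
- move=> t u t0; rewrite /euclid.
  under eq_bigr do rewrite mxE exprMn.
  by rewrite -mulr_sumr sqrtrM ?sqr_ge0 // sqrtr_sqr ger0_norm.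
- move=> u; apply: mx_norm_le => [|j]; first exact: sqrtr_ge0.
  rewrite -sqrtr_sqr /euclid ler_sqrt; last by apply: sumr_ge0 => i _; exact: sqr_ge0.
  by rewrite (bigD1 j) //= lerDl; apply: sumr_ge0 => i _; exact: sqr_ge0.
Qed.

Lemma euclid_ball : [set u | euclid u <= 1]%classic = @unit_ball R n.
Proof.
by apply/seteqP; split=> u /=; rewrite /euclid -[leRHS]sqrtr1 ler_sqrt.
Qed.

End Radial.

(** * The cone over the boundary of a simplex is a ball *)

Section ConeBall.
Local Open Scope fset_scope.
Local Open Scope ring_scope.
Variables (R : realType) (K : choiceType) (V : {fset K}).

Lemma continuous_rowP (T : topologicalType) n (f : T -> 'rV[R]_n) :
  (forall j, continuous (fun x => f x 0 j)) -> continuous f.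
Proof.
move=> cf x A [P hP sPA].
have h : (\forall y \near x, forall j, P 0 j (f y 0 j))%classic.
  by apply: (@filter_forall T _ _ _ (nbhs_filter x)) => j; apply: cf; exact: hP.
by apply: filterS h => y Py; apply: sPA => i j; rewrite ord1.
Qed.

Section Coordinates.
Variables (a : {fset K}) (v0 : K).
Hypotheses (v0a : v0 \in a) (aV : a `<=` V).
Let n := #|` a `\ v0|.
Let e (j : 'I_n) : K := nth v0 (a `\ v0) j.
Implicit Types (x : {ptws K -> R}) (u : 'rV[R]_n).

Let e_in j : e j \in a `\ v0. Proof. exact: mem_nth. Qed.
Let e_a j : e j \in a. Proof. by have := e_in j; rewrite !inE => /andP[]. Qed.
Let e_v0 j : (e j == v0) = false.
Proof. by have := e_in j; rewrite !inE => /andP[/negPf]. Qed.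
Let e_inj : injective e.
Proof.
by move=> i j /eqP; rewrite nth_uniq ?fset_uniq // => /eqP/val_inj.
Qed.
Let a_cases v : v \in a -> v = v0 \/ exists j, v = e j.
Proof.
move=> va; have [->|vv0] := eqVneq v v0; [by left|right].
have vr : v \in (a `\ v0 : seq K) by rewrite -[_ \in _]/(v \in a `\ v0) !inE vv0.
have vn : (index v (a `\ v0) < n)%N by rewrite index_mem.
by exists (Ordinal vn); rewrite /e /= nth_index.
Qed.

Let sum_coord (F : K -> R) : (forall v, v \notin a -> F v = 0) ->
  \sum_(v <- V) F v = F v0 + \sum_j F (e j).
Proof.
move=> F0; rewrite -(big_fset_incl _ aV) => [|v _]; last exact: F0.
by rewrite (big_fsetD1 v0) //= (big_nth v0) big_mkord.
Qed.

(** The default [0] stands for the coordinate at [v0]. *)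
Definition low u : R := \big[Num.min/0]_j u 0 j.

(** The mass of [of_row u]: each of the [n.+1] vertices of [a] has its coordinate lowered by
    [low u]. *)
Definition simplex_gauge u : R := \sum_j u 0 j - n.+1%:R * low u.

(** Coordinates modulo constants on [a], normalised at [v0]. Each class has exactly one nonnegative
    representative with a zero, that is, one whose support is a proper face of [a]. *)
Definition to_row x : 'rV[R]_n := \row_j (x (e j) - x v0).

(* The representative, modulo constants on [a], with minimum [0]. *)
Definition of_row u : {ptws K -> R} := fun v =>
  if v \in a then \sum_(j | e j == v) u 0 j - low u else 0.

Lemma low_le u j : low u <= u 0 j.
Proof. by rewrite /low (bigD1 j) //= ge_min lexx. Qed.

Lemma low_le0 u : low u <= 0.
Proof.
rewrite /low; elim/big_rec: _ => // j x _ x0.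
by rewrite ge_min x0 orbT.
Qed.

Lemma low_ge u t : t <= 0 -> (forall j, t <= u 0 j) -> t <= low u.
Proof.
by move=> t0 h; rewrite /low; elim/big_ind: _ => // p q; rewrite le_min => -> ->.
Qed.

Lemma low_attained u : low u = 0 \/ exists j, low u = u 0 j.
Proof.
rewrite /low; elim/big_ind: _ => [|x y hx hy|j _]; [by left| |by right; exists j].
by rewrite /Num.min; case: ifP.
Qed.

Let of_row_v0 u : of_row u v0 = - low u.
Proof.
rewrite /of_row v0a big_pred0 ?sub0r // => j; exact: e_v0.
Qed.

Let of_row_e u j : of_row u (e j) = u 0 j - low u.
Proof.
rewrite /of_row e_a (big_pred1 j) // => i /=.
by rewrite (inj_eq e_inj).
Qed.

Lemma mass_of_row u : mass V (of_row u) = simplex_gauge u.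
Proof.
rewrite /mass sum_coord => [|v /negPf va]; last by rewrite /of_row va.
rewrite of_row_v0; under eq_bigr do rewrite of_row_e.
rewrite big_split /= sumr_const card_ord /simplex_gauge -mulr_natl -natr1.
ring.
Qed.

Lemma of_row_ge0 u v : 0 <= of_row u v.
Proof.
have [va|/negPf va] := boolP (v \in a); last by rewrite /of_row va.
case: (a_cases va) => [->|[j ->]]; first by rewrite of_row_v0 oppr_ge0 low_le0.
by rewrite of_row_e subr_ge0 low_le.
Qed.

Lemma continuous_low : continuous low.
Proof.
apply: (@continuous_bigmin_seq R _ _ _ _ (fun j (u : 'rV[R]_n) => u 0 j)) => j.
exact: coord_continuous.
Qed.

Lemma low_hom t u : 0 <= t -> low (t *: u) = t * low u.
Proof.
move=> t0; apply/eqP; rewrite eq_le; apply/andP; split; last first.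
  apply: low_ge => [|j]; first by rewrite mulr_ge0_le0 // low_le0.
  by rewrite mxE ler_wpM2l // low_le.
case: (low_attained u) => [->|[j ->]]; first by rewrite mulr0 low_le0.
by apply: le_trans (low_le _ j) _; rewrite mxE.
Qed.

Lemma simplex_gauge_gauge : gauge simplex_gauge.
Proof.
split.
- apply: continuous_subr.
    apply: (@continuous_sum_seq R _ _ _ (fun j (u : 'rV[R]_n) => u 0 j)) => j.
    exact: coord_continuous.
  by apply: continuous_mulr; [exact: continuous_cst|exact: continuous_low].
- move=> t u t0; rewrite /simplex_gauge low_hom //.
  under eq_bigr do rewrite mxE.
  by rewrite -mulr_sumr; ring.
- move=> u; rewrite -mass_of_row.
  have mass_ge v : v \in a -> of_row u v <= mass V (of_row u).
    move=> va; rewrite /mass (big_fsetD1 v) ?(fsubsetP aV) //= lerDl.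
    by apply: sumr_ge0 => w _; exact: of_row_ge0.
  apply: mx_norm_le => [|j].
    by apply: le_trans (mass_ge _ v0a); exact: of_row_ge0.
  (* [u 0 j] is the difference of two entries of [of_row u], both between [0] and the mass. *)
  have h0 := mass_ge _ v0a; have h1 := mass_ge _ (e_a j).
  have := of_row_ge0 u v0; have := of_row_ge0 u (e j).
  rewrite of_row_v0 in h0 *; rewrite of_row_e in h1 * => p1 p2.
  by rewrite ler_norml; apply/andP; split; lra.
Qed.

(** Some coordinate of [x] in [a] vanishes and none is negative, so the lowest difference with
    [x v0] is attained there; the default [0] serves when the vanishing one is at [v0]. *)
Lemma low_to_row x : cone V (simplex_boundary a) x -> low (to_row x) = - x v0.
Proof.
move=> [s]; rewrite mem_simplex_boundary => /andP[sa /fsubsetPn[v va vs]] [[x0 xN] _].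
apply/eqP; rewrite eq_le; apply/andP; split; last first.
  apply: low_ge => [|j]; first by rewrite oppr_le0.
  by rewrite mxE lerBrDr addNr.
have xv := xN v vs; case: (a_cases va) => [vv0|[j vj]].
  by apply: le_trans (low_le0 _) _; rewrite -vv0 xv oppr0.
by apply: le_trans (low_le _ j) _; rewrite mxE -vj xv sub0r.
Qed.

Lemma to_rowK x : cone V (simplex_boundary a) x -> of_row (to_row x) = x.
Proof.
move=> cx; apply/funext => v; have [va|va] := boolP (v \in a).
  case: (a_cases va) => [->|[j ->]]; rewrite ?of_row_v0 ?of_row_e low_to_row //.
    by rewrite opprK.
  by rewrite mxE opprK subrK.
rewrite /of_row (negPf va); case: cx => s; rewrite mem_simplex_boundary.
by move=> /andP[sa _] [[_ ->]] //; apply: contra va; exact: fsubsetP.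
Qed.

Lemma of_rowK u : to_row (of_row u) = u.
Proof. by apply/rowP => j; rewrite mxE of_row_e of_row_v0 opprK subrK. Qed.

Lemma of_row_cone u : simplex_gauge u <= 1 ->
  cone V (simplex_boundary a) (of_row u).
Proof.
move=> gu; have [v va uv] : exists2 v, v \in a & of_row u v = 0.
  case: (low_attained u) => [l0|[j lj]].
    by exists v0; rewrite // of_row_v0 l0 oppr0.
  by exists (e j); rewrite // of_row_e lj subrr.
exists (a `\ v); last split; last by rewrite mass_of_row.
  by rewrite mem_simplex_boundary fsubD1set fsubsetD1 va andbF.
split=> [w|w]; first exact: of_row_ge0.
by rewrite !inE negb_and negbK => /orP[/eqP -> //|/negPf wa]; rewrite /of_row wa.
Qed.

Lemma cone_simplex_gauge : global_homeo (@cone R K V (simplex_boundary a))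
  [set u | simplex_gauge u <= 1]%classic.
Proof.
exists to_row, of_row; split.
- apply: continuous_rowP => j.
  have -> : (fun x => to_row x 0 j) = (fun x => x (e j) - x v0).
    by apply/funext => x; rewrite mxE.
  by apply: continuous_subr; exact: continuous_eval.
- apply: continuous_ptws => v; rewrite /of_row; case: (v \in a); last exact: continuous_cst.
  apply: continuous_subr; last exact: continuous_low.
  have -> : (fun u : 'rV[R]_n => \sum_(j | e j == v) u 0 j) =
      (fun u => \sum_j if e j == v then u 0 j else 0).
    by apply/funext => u; rewrite big_mkcond.
  apply: (@continuous_sum_seq R _ _ _
    (fun j (u : 'rV[R]_n) => if e j == v then u 0 j else 0)) => j.
  by case: (e j == v); [exact: coord_continuous|exact: continuous_cst].
- move=> x cx; split; last exact: to_rowK.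
  by rewrite /= -mass_of_row to_rowK //; case: cx => s _ [].
- by move=> u gu; split; [exact: of_row_cone|exact: of_rowK].
Qed.

End Coordinates.

Lemma cone_simplex_boundary_ball (a : {fset K}) n : #|` a| = n.+1 -> a `<=` V ->
  global_homeo (@cone R K V (simplex_boundary a)) (@unit_ball R n).
Proof.
move=> ca aV; have [v0 v0a] : exists v, v \in a.
  by apply/fset0Pn; rewrite -cardfs_gt0 ca.
have -> : n = #|` a `\ v0| by rewrite cardfsD1_in // ca.
apply: global_homeo_comp (cone_simplex_gauge v0a aV) _.
rewrite -euclid_ball; apply: gauge_homeo; last exact: euclid_gauge.
exact: simplex_gauge_gauge.
Qed.

End ConeBall.

(** * Stellated spheres *)

Section Stellated.
Local Open Scope fset_scope.
Variables (R : realType) (K : choiceType) (d k : nat).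
Implicit Types (X Y Z S : {fset {fset K}}) (V a b s : {fset K}).

Lemma sub_vertices X s : s \in X -> s `<=` vertices X.
Proof. by move=> sX; apply: bigfcup_sup. Qed.

Lemma k_stellated_filling S : 2 * k <= d -> k_stellated d k S ->
  normal_pseudomanifold d S /\ stacked_filling d k S (filling k S).
Proof.
move=> hd; elim=> [a ca|i a b X Y _ [NX FX] ik M].
  have kd : k <= d by lia.
  split; first exact: simplex_boundary_normal.
  by rewrite (filling_simplex_boundary ca kd); exact: stacked_filling_simplex_boundary.
split; first exact: move_normal NX M.
exact: stacked_filling_move hd ik NX M FX erefl.
Qed.

(** Both claims are proved for any fixed [V] containing the final vertices, so that all complexes of
    the sequence share one ambient simplex. *)
Lemma k_stellated_cone S V : 2 * k <= d -> k_stellated d k S -> vertices S `<=` V ->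
  cone_filling R V S (filling k S) /\ global_homeo (@cone R K V S) (@unit_ball R d.+1).
Proof.
move=> hd; elim=> [a ca|i a b X Y SX IH ik M] VS.
  have aV : a `<=` V.
    apply: fsubset_trans VS; apply/fsubsetP => v va.
    rewrite mem_vertices; last by have [[]] := simplex_boundary_normal ca.
    rewrite mem_simplex_boundary fsub1set va /=; apply/negP => /fsubset_leq_card.
    by rewrite cardfs1 ca.
  split; last exact: cone_simplex_boundary_ball.
  rewrite (filling_simplex_boundary ca); last by lia.
  by apply: cone_filling_simplex_boundary; rewrite // -cardfs_gt0 ca.
have [NX FX] := k_stellated_filling hd SX.
have E := move_exchange NX M; have cY := move_complex NX M.
have [[cX _] [ab a0] [cb cab] _ _] := M.
(* [a] has more than one element, so a move deletes no vertex and [V] still contains those of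
   [X]. *)
have aN v : ~~ (a `<=` [fset v]).
  by apply/negP => /fsubset_leq_card; rewrite cardfs1; lia.
have XV : vertices X `<=` V.
  apply: fsubset_trans VS; apply/fsubsetP => v; rewrite !mem_vertices // => vX.
  exact: (exch_XY E).
have abV : a `|` b `<=` V.
  apply: fsubset_trans VS; apply/fsubsetP => v vab; rewrite mem_vertices //.
  by apply: (exch_Y E) => //; rewrite fsub1set.
have subV Z s : vertices Z `<=` V -> s \in Z -> s `<=` V.
  by move=> ZV sZ; apply: fsubset_trans (sub_vertices sZ) ZV.
have bZ s : s \in filling k X -> ~~ (b `<=` s).
  move=> /(mem_filling_complex _ _ cX) h; apply/negP => bs.
  have /(exch_b E) : b \in X by apply: h => //; lia.
  by rewrite fsubset_refl.
have [CX BX] := IH XV; split.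
  rewrite (filling_move hd ik NX M erefl).
  apply: (cone_filling_exchange abV ab a0 E) => //.
  - by case: cX.
  - by case: cY.
  - by move=> s; exact: subV.
  - by move=> s; exact: subV.
  - by move=> s /mem_filling[sX _]; exact: fsubset_trans sX XV.
  - by move=> s sab /bZ; exact: (exch_X E).
apply: (fun h => global_homeo_comp h BX); apply: global_homeo_sym.
have [aV bV] : a `<=` V /\ b `<=` V by move: abV; rewrite fsubUset => /andP.
have b0 : false || (b != fset0) by rewrite -cardfs_gt0 cb.
(* Without apex nothing is glued, and [flip] is a homeomorphism between the two cones. *)
have domE : @flip_domain R K V a b false X = cone V X.
  by apply/seteqP; split=> x; [case=> // -[]|left].
rewrite -domE; apply: (flip_homeo R aV bV ab a0 b0 E).
- by case: cX.
- by case: cY.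
- by move=> s; exact: subV.
- by move=> s; exact: subV.
Qed.

(** The carrier of the filling is its cone base, which [phi] maps to the cone over [S], a ball. *)
Lemma filling_ball S : 2 * k <= d -> k_stellated d k S ->
  triangulated_ball R d.+1 (filling k S).
Proof.
move=> hd SS; have [_ FS] := k_stellated_filling hd SS.
split; first by case: (fill_pure FS).
have [[phi [psi [[cphi cpsi] phiP psiP _ _]]] BS] :=
  k_stellated_cone hd SS (fsubset_refl (vertices S)).
apply: global_homeo_homeomorphic.
rewrite -(@cone_base_carrier R K (vertices S)); last by move=> s /mem_filling[].
by apply: (fun h => global_homeo_comp h BS); exists phi, psi.
Qed.

End Stellated.

Theorem proposition2p11 (R : realType) (K : choiceType) (k d : nat)
    (S : {fset {fset K}}) (hd : 2 * k <= d) (hS : k_stellated d k S) :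
  exists Sbar : {fset {fset K}},
    [/\ unique (fun B : {fset {fset K}} =>
          k_stacked_ball R d k B /\ boundary d.+1 B = S) Sbar,
        k_shelled d.+1 k Sbar
      & forall a : {fset K},
          a \in Sbar <->
          (a `<=` vertices S)%fset /\
          (forall b : {fset K}, (b `<=` a)%fset -> #|` b| <= k.+1 -> b \in S)].
Proof.
have [[pS _ _] FS] := k_stellated_filling hd hS.
have [[cS _] [cF _]] := (pS, fill_pure FS).
have dF : boundary d.+1 (filling k S) = S.
  by apply: (boundary_eqP pS cF) => r cr; exact: (fill_boundary FS cr).
exists (filling k S); split; last exact: mem_filling.
- split; first split=> //; first split; first exact: filling_ball.
    by move=> a aF ak; rewrite dF; exact: fill_stacked FS _ aF ak.
  move=> B [[[cB _] sB] dB]; exact: stacked_filling_unique hd cS FS pS cB dB sB.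
- by split; [exact: filling_pseudomanifold FS|exact: fill_shelled FS].
Qed.
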